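(* Let $d\in\mathbb{N}$, $I_d\subseteq\{1,\ldots,d\}$, and let $n\in\mathbb{N}$ be prime with $n\ge c_R$. Let $z_1^*\in\{1,\ldots,n-1\}$ be arbitrary, and for $\ell=2,\ldots,d$ successively choose $z_\ell^*\in\mathbb{Z}_n$ as a minimizer of $z_\ell\mapsto B_{I_d,\ell}(z_1^*,\ldots,z_{\ell-1}^*,z_\ell)$ over $z_\ell\in\mathbb{Z}_n$, where $$B_{I_d,\ell}(z_1,\ldots,z_\ell):=\sum_{\substack{\mathfrak{u}\subseteq\{1,\ldots,\ell\},\\ \ell\in\mathfrak{u}}} c_{\mathfrak{u},I_d}^{-1}\sum_{\mathbf{h}_{\mathfrak{u}}\in(\mathbb{Z}\setminus\{0\})^{\mathfrak{u}}}\frac{\mathbb{M}_{\mathfrak{u},I_d}(\mathbf{h}_{\mathfrak{u}})!}{\#\mathcal{S}_{\mathfrak{u},I_d}}\, r_{\alpha,\boldsymbol{\beta}}^{-1}(\mathbf{h}_{\mathfrak{u}})\,\mathbf{1}\{\mathbf{h}_{\mathfrak{u}}\in L(\mathbf{z}_{\mathfrak{u}},n)^{\perp}\},\qquad c_{\mathfrak{u},I_d}:=\beta_0^{\#\mathfrak{u}}\binom{\#I_d}{\#(I_d\cap\mathfrak{u})}.$$ Then there exists $\boldsymbol{\Delta}^*\in[0,1)^d$ such that the shifted rank-1 lattice rule $Q_{d,n}:=Q_{d,n}(z_1^*,\ldots,z_d^* )+\boldsymbol{\Delta}^*$ satisfies $$e^{\mathrm{wor}}(Q_{d,n};\mathfrak{S}_{I_d}(F_d(r_{\alpha,\boldsymbol{\beta}})))^2\le(1+c_R)^\lambda\,C_{d,\lambda}(r_{\alpha,\boldsymbol{\beta}})\,\max\{1,\#I_d\}\,\frac{1}{n^\lambda}\quad\text{for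 all }1\le\lambda<2\alpha,$$ where $C_{d,\lambda}(r_{\alpha,\boldsymbol{\beta}}):=\Big(\sum_{\mathbf{0}\ne\mathbf{h}\in\mathbb{Z}^d}\Big[\frac{\mathbb{M}_d(\mathbf{h})!}{\#\mathcal{S}_d}\,r_{\alpha,\boldsymbol{\beta}}^{-1}(\mathbf{h})\Big]^{1/\lambda}\Big)^\lambda$.
   Context: Standing setting. $R\colon[1,\infty)\to(0,\infty)$ is a function such that $\frac{1}{c_R}R(m)\le \frac{R(nm)}{n}\le R(m)$ for all $n,m\in\mathbb{N}$ with some constant $c_R\ge 1$, and $\mu_R(\alpha):=\sum_{m=1}^\infty R(m)^{-2\alpha}<\infty$ for the smoothness parameter $\alpha\ge 0$ (these imply $\alpha>1/2$). $\boldsymbol{\beta}=(\beta_0,\beta_1)$ are positive parameters. For a nonempty finite index set $\mathfrak{u}$ and $\mathbf{k}\in\mathbb{Z}^{\mathfrak{u}}$ put $r_{\alpha,\boldsymbol{\beta}}(\mathbf{k}):=\prod_{\ell\in\mathfrak{u}}\big(\delta_{0,k_\ell}\beta_0^{-1}+(1-\delta_{0,k_\ell})\beta_1^{-1}R(|k_\ell|)^{2\alpha}\big)$. The space $F_d(r_{\alpha,\boldsymbol{\beta}})$ consists of all $f\in L_2([0,1]^d)$ (complex valued) with $\|f\|^2:=\sum_{\mathbf{k}\in\mathbb{Z}^d}|\hat f(\mathbf{k})|^2 r_{\alpha,\boldsymbol{\beta}}(\mathbf{k})<\infty$, where $\hat f(\mathbf{k})=\int_{[0,1]^d}f(\mathbf{x})e^{-2\pi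 i\mathbf{k}\cdot\mathbf{x}}\,d\mathbf{x}$. Permutation invariance. For $I_d\subseteq\{1,\ldots,d\}$ let $\mathcal{S}_d$ be the set of bijections $P$ of $\{1,\ldots,d\}$ with $P(j)=j$ for all $j\notin I_d$, and write $P(\mathbf{x}):=(x_{P(1)},\ldots,x_{P(d)})$. The subspace $\mathfrak{S}_{I_d}(F_d(r_{\alpha,\boldsymbol{\beta}}))$ consists of all $f\in F_d(r_{\alpha,\boldsymbol{\beta}})$ with $f(\mathbf{x})=f(P(\mathbf{x}))$ for all $\mathbf{x}\in[0,1]^d$, $P\in\mathcal{S}_d$, with the same norm. For nonempty $\mathfrak{u}\subseteq\{1,\ldots,d\}$ let $\mathcal{S}_{\mathfrak{u},I_d}$ be the set of bijections $P$ of $\mathfrak{u}$ with $P(j)=j$ for $j\in\mathfrak{u}\setminus I_d$, and for $\mathbf{h}_{\mathfrak{u}}\in\mathbb{Z}^{\mathfrak{u}}$ let $\mathbb{M}_{\mathfrak{u},I_d}(\mathbf{h}_{\mathfrak{u}})!:=\#\{P\in\mathcal{S}_{\mathfrak{u},I_d}: P(\mathbf{h}_{\mathfrak{u}})=\mathbf{h}_{\mathfrak{u}}\}$; $\mathbb{M}_d(\mathbf{h})!$ denotes this quantity for $\mathfrak{u}=\{1,\ldots,d\}$. For $\mathbf{h}\in\mathbb{Z}^d$ (or $\mathbf{z}$), $\mathbf{h}_{\mathfrak{u}}=(h_j)_{j\in\mathfrak{u}}$ denotes the restriction. Lattice rules. $\mathbb{Z}_n:=\{0,\ldots,n-1\}$.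 For prime $n$ and $\mathbf{z}\in\mathbb{Z}_n^d$, the shifted rank-1 lattice rule $Q_{d,n}(\mathbf{z})+\boldsymbol{\Delta}$, $\boldsymbol{\Delta}\in[0,1)^d$, is $f\mapsto\frac1n\sum_{j=0}^{n-1}f(\{j\mathbf{z}/n+\boldsymbol{\Delta}\})$, with $\{\cdot\}$ the componentwise fractional part. For nonempty $\mathfrak{u}$, $L(\mathbf{z}_{\mathfrak{u}},n)^\perp:=\{\mathbf{h}_{\mathfrak{u}}\in\mathbb{Z}^{\mathfrak{u}}:\mathbf{h}_{\mathfrak{u}}\cdot\mathbf{z}_{\mathfrak{u}}\equiv 0\pmod n\}$. The worst case error of a cubature rule $Q$ on a normed function space $H$ is $e^{\mathrm{wor}}(Q;H):=\sup_{\|f\|_H\le1}|\int_{[0,1]^d}f-Q(f)|$. *)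

(* Defs.v *)
From HB Require Import structures.
From mathcomp Require Import all_boot all_order all_algebra.
From mathcomp Require Import fingroup perm.
From mathcomp Require Import all_classical all_reals all_analysis.
Set Implicit Arguments. Unset Strict Implicit. Unset Printing Implicit Defensive.
Import Order.TTheory GRing.Theory Num.Theory.
Import numFieldNormedType.Exports.
Local Open Scope classical_set_scope.
Local Open Scope ring_scope.

Section Defs.
Context {R : realType} {d : nat}.

(* The unit cube [0,1]^d, points are row vectors; coordinates are indexed by
   'I_d, i.e. coordinate j+1 of the paper is index j here. *)
Definition cube : set 'rV[R]_d := [set x | forall i, 0 <= x ord0 i <= 1].

Record cfun := CFun { Re_f : 'rV[R]_d -> R; Im_f : 'rV[R]_d -> R }.

Definition upd (x : 'rV[R]_d) (k : nat) (t : R) : 'rV[R]_d :=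
  \row_i (if val i == k then t else x ord0 i).

Fixpoint iter_int (k : nat) (g : 'rV[R]_d -> R) (x : 'rV[R]_d) : R :=
  match k with
  | 0 => g x
  | k'.+1 => \int[@lebesgue_measure R]_(t in `[0, 1]) iter_int k' g (upd x k' t)
  end.

(* integral over [0,1]^d (of continuous functions: iterated = Lebesgue) *)
Definition cube_int (g : 'rV[R]_d -> R) : R := iter_int d g 0.

Definition kdot (k : {ffun 'I_d -> int}) (x : 'rV[R]_d) : R :=
  \sum_i (k i)%:~R * x ord0 i.

(* Fourier coefficient  \hat f(k) = \int f(x) exp(-2 pi i k.x) dx  *)
Definition fourier_re (f : cfun) (k : {ffun 'I_d -> int}) : R :=
  cube_int (fun x => Re_f f x * cos (2 * pi * kdot k x)
                     + Im_f f x * sin (2 * pi * kdot k x)).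
Definition fourier_im (f : cfun) (k : {ffun 'I_d -> int}) : R :=
  cube_int (fun x => Im_f f x * cos (2 * pi * kdot k x)
                     - Re_f f x * sin (2 * pi * kdot k x)).

Definition r_ab (Rf : R -> R) (alpha beta0 beta1 : R) (u : {set 'I_d})
    (h : {ffun 'I_d -> int}) : R :=
  \prod_(l in u) (if h l == 0 then beta0^-1
                  else beta1^-1 * (Rf (absz (h l))%:R) `^ (2 * alpha)).

Definition Fnorm2 Rf alpha beta0 beta1 (f : cfun) : \bar R :=
  \esum_(k in [set: {ffun 'I_d -> int}])
    (((fourier_re f k) ^+ 2 + (fourier_im f k) ^+ 2)
       * r_ab Rf alpha beta0 beta1 [set: 'I_d]%SET k)%:E.

(* f belongs to F_d(r_{alpha,beta}) (continuous representative) *)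
Definition in_Fd Rf alpha beta0 beta1 (f : cfun) : Prop :=
  continuous (from_subspace cube (Re_f f)) /\ continuous (from_subspace cube (Im_f f)) /\
  (Fnorm2 Rf alpha beta0 beta1 f < +oo)%E.

Definition permx (P : {perm 'I_d}) (x : 'rV[R]_d) : 'rV[R]_d :=
  \row_i x ord0 (P i).

Definition in_SFd Rf alpha beta0 beta1 (I : {set 'I_d}) (f : cfun) : Prop :=
  in_Fd Rf alpha beta0 beta1 f /\
  forall (P : {perm 'I_d}), perm_on I P -> forall x, cube x ->
    Re_f f x = Re_f f (permx P x) /\ Im_f f x = Im_f f (permx P x).

Definition frac (x : R) : R := x - (Num.floor x)%:~R.

Definition lat_pt (n : nat) (z : 'I_d -> nat) (Delta : 'rV[R]_d) (j : nat)
  : 'rV[R]_d :=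
  \row_i frac (j%:R * (z i)%:R / n%:R + Delta ord0 i).

Definition cubature_err (n : nat) (z : 'I_d -> nat) (Delta : 'rV[R]_d)
    (f : cfun) : R :=
  let qre := n%:R^-1 * \sum_(j < n) Re_f f (lat_pt n z Delta j) in
  let qim := n%:R^-1 * \sum_(j < n) Im_f f (lat_pt n z Delta j) in
  Num.sqrt ((cube_int (Re_f f) - qre) ^+ 2 + (cube_int (Im_f f) - qim) ^+ 2).

Definition wce Rf alpha beta0 beta1 (I : {set 'I_d}) (n : nat)
    (z : 'I_d -> nat) (Delta : 'rV[R]_d) : \bar R :=
  ereal_sup [set (cubature_err n z Delta f)%:E | f in
     [set f | in_SFd Rf alpha beta0 beta1 I f /\
              (Fnorm2 Rf alpha beta0 beta1 f <= 1)%E]].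

(* S_{u,I_d}: bijections of u fixing u \ I_d, realised as permutations of
   'I_d supported in u :&: I_d *)
Definition Sset (u I : {set 'I_d}) : {set {perm 'I_d}} :=
  [set P : {perm 'I_d} | perm_on (u :&: I) P].

Definition Mfact (u I : {set 'I_d}) (h : {ffun 'I_d -> int}) : nat :=
  #|[set P in Sset u I | [forall j in u, h (P j) == h j]]|.

(* (Z \ {0})^u, realised as integer vectors vanishing exactly off u *)
Definition nonzero_on (u : {set 'I_d}) : set {ffun 'I_d -> int} :=
  [set h | forall j, (j \in u) = (h j != 0)].

Definition in_dual (n : nat) (z : 'I_d -> nat) (u : {set 'I_d})
    (h : {ffun 'I_d -> int}) : bool :=
  (n%:Z %| \sum_(j in u) h j * (z j)%:Z)%Z.

Definition c_uI (beta0 : R) (u I : {set 'I_d}) : R :=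
  beta0 ^+ #|u| * ('C(#|I|, #|I :&: u|))%:R.

(* B_{I_d, l}(z_1,...,z_l); only z_1..z_l (indices <= l) are used *)
Definition B_crit Rf alpha beta0 beta1 (I : {set 'I_d}) (n : nat)
    (z : 'I_d -> nat) (l : 'I_d) : \bar R :=
  (\sum_(u : {set 'I_d} | (u \subset [set j : 'I_d | (val j <= val l)%N])
                           && (l \in u))
     ((c_uI beta0 u I)^-1)%:E *
     \esum_(h in nonzero_on u)
       ((Mfact u I h)%:R / (#|Sset u I|)%:R
          * (r_ab Rf alpha beta0 beta1 u h)^-1
          * (if in_dual n z u h then 1 else 0))%:E)%E.

Definition C_const Rf alpha beta0 beta1 (I : {set 'I_d}) (lam : R) : \bar R :=
  ((\esum_(h in [set h : {ffun 'I_d -> int} | [exists j, h j != 0%R]])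
      (((Mfact [set: 'I_d]%SET I h)%:R / (#|Sset [set: 'I_d]%SET I|)%:R
         * (r_ab Rf alpha beta0 beta1 [set: 'I_d]%SET h)^-1) `^ (lam^-1))%:E) `^ lam)%E.

End Defs.

(* Main.v *)
(* The worst case error of the lattice rule with shift Delta is bounded through the
   absolutely convergent Fourier series of the integrand: after averaging over the
   permutations, Cauchy-Schwarz gives e(Delta)^2 <= G(Delta), where G is a series of
   squares of trigonometric polynomials in Delta.  The mean of G over the cube is at
   most M, the sum of w(h) = M_d(h)!/#S_d * r(h)^-1 over the nonzero h in the dual
   lattice, so some shift satisfies e(Delta)^2 <= M.

   Sorting the frequencies h by their last nonzero index l turns M into the sum over l
   of beta_0^d B_l(z).  By the choice of z_l, B_l^(1/lam) is at most its average over
   all candidates for z_l, and Jensen's inequality moves the power inside the sum.  For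
   n not dividing h_l at most one candidate in n puts h into the dual lattice; the h with
   n | h_l are compared with h_l / n, at the cost of the factor max(1, #I_d) c_R / n. *)
Require Import Defs.
From HB Require Import structures.
From mathcomp Require Import all_boot all_order all_algebra.
From mathcomp Require Import fingroup perm.
From mathcomp Require Import all_classical all_reals all_analysis.
From mathcomp Require Import ring lra zify.
Set Implicit Arguments. Unset Strict Implicit. Unset Printing Implicit Defensive.
Import Order.TTheory GRing.Theory Num.Theory.
Import numFieldNormedType.Exports.
Local Open Scope classical_set_scope.
Local Open Scope ring_scope.

(** * Iterated integrals of uniformly continuous functions *)

Section UnitInterval.
Context {R : realType}.
Implicit Types f g : R -> R.

(** The integral over the cube is iterated in a fixed order, coordinate 0 innermost. Uniform
    continuity on the cube is the working class: it passes to slices and to partial integrals, and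
    gives integrability at every stage. Complex exponentials are replaced by cosines with a phase, a
    family that contains the sines and whose products are again sums of its members. Finiteness of
    mu makes the Fourier coefficients of an integrand absolutely summable. That the resulting series
    represents the integrand rests on uniqueness of Fourier coefficients, obtained in one variable
    by Lebesgue's concentration argument and then coordinate by coordinate. In the factor 1 + cR,
    the 1 comes from the single candidate that can put [h] into the dual lattice, and cR from the
    frequencies whose last nonzero entry is a multiple of n. The hypothesis cR <= n allows (cR /
    n)^(2 alpha / lam) to be replaced by cR / n. The mean M does not involve lam, so one shift
    serves every lam. *)

Definition uc01 f := forall e : R, 0 < e -> exists2 del : R, 0 < del &
  forall s t, 0 <= s <= 1 -> 0 <= t <= 1 -> `|s - t| < del -> `|f s - f t| < e.

Definition int01 f : R := \int[@lebesgue_measure R]_(t in `[0, 1]) f t.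

Lemma uc01_within f : uc01 f -> {within `[0, 1]%classic, continuous f}.
Proof.
move=> fu; apply/subspace_continuousP => x /= x01.
apply/cvgrPdist_lt => e e0; have [del del0 H] := fu e e0.
rewrite near_withinE; near=> t => t01.
move: x01 t01; rewrite /= !in_itv /= => x01 t01.
apply: H => //; near: t; exact: nbhsx_ballx.
Unshelve. all: by end_near. Qed.

(** Heine-Cantor, with compactness in its near-covering form: the modulus runs through the filter
    [0^'+], and a modulus that works near each point works on the whole interval. *)
Lemma continuous_uc01 f : continuous f -> uc01 f.
Proof.
move=> cf e e0; have /compact_near_coveringP/near_covering_withinP H := @segment_compact R 0 1.
have := H _ (0^'+ : set_system R)
  (fun del s => forall t, `|s - t| < del -> `|f s - f t| < e) _.
case.
  move=> x _; have /cvgrPdist_lt /(_ (e / 2)) := cf x.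
  rewrite divr_gt0 // => /(_ isT) /nbhs_ballP[r /= r0 rH].
  near=> s del => /= _ t st.
  have sx : `|x - s| < r / 2 by near: s; apply: nbhsx_ballx; rewrite divr_gt0.
  have delr : del < r / 2 by near: del; apply: nbhs_right_lt; rewrite divr_gt0.
  have tx : `|x - t| < r.
    rewrite (_ : x - t = (x - s) + (s - t)); last by ring.
    by rewrite (le_lt_trans (ler_normD _ _)) // (splitr r) ltrD // (lt_trans st).
  have s2 : `|x - s| < r by rewrite (lt_le_trans sx) //; lra.
  have := rH _ s2; have := rH _ tx => /= h1 h2.
  rewrite (_ : f s - f t = (f x - f t) - (f x - f s)); last by ring.
  by rewrite (le_lt_trans (ler_normB _ _)) // (splitr e) ltrD.
move=> r /= r0 rH.
exists (r / 2); first by rewrite divr_gt0.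
move=> s t s01 _ st; apply: (rH (r / 2)) => //=.
- by rewrite sub0r normrN gtr0_norm ?divr_gt0 //; lra.
- by rewrite divr_gt0.
Unshelve. all: by end_near. Qed.

Lemma uc01_integrable f : uc01 f ->
  (@lebesgue_measure R).-integrable `[0, 1]%classic (EFin \o f).
Proof.
move=> /uc01_within cf; apply: continuous_compact_integrable => //.
exact: segment_compact.
Qed.

Lemma uc01_cst c : uc01 (fun=> c).
Proof. by move=> e e0; exists 1 => // s t _ _ _; rewrite subrr normr0. Qed.

Lemma uc01D f g : uc01 f -> uc01 g -> uc01 (fun t => f t + g t).
Proof.
move=> uf ug e e0; have e2 : 0 < e / 2 by rewrite divr_gt0.
have [a a0 fa] := uf _ e2; have [b b0 gb] := ug _ e2.
exists (Num.min a b); first by rewrite lt_min a0.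
move=> s t s01 t01; rewrite lt_min => /andP[sa sb].
rewrite (_ : _ - _ = (f s - f t) + (g s - g t)); last by ring.
by rewrite (le_lt_trans (ler_normD _ _)) // (splitr e) ltrD // ?fa ?gb.
Qed.

Lemma uc01Z c f : uc01 f -> uc01 (fun t => c * f t).
Proof.
move=> uf e e0; have c1 : 0 < `|c| + 1 by rewrite ltr_wpDl.
have [a a0 fa] := uf (e / (`|c| + 1)) (divr_gt0 e0 c1).
exists a => // s t s01 t01 st; rewrite -mulrBr normrM.
have := fa s t s01 t01 st; rewrite ltr_pdivlMr // => h.
by rewrite mulrC (le_lt_trans _ h) // ler_wpM2l // lerDl.
Qed.

Lemma eq_int01 f g : (forall t, 0 <= t <= 1 -> f t = g t) -> int01 f = int01 g.
Proof. by move=> fg; apply: eq_Rintegral => t; rewrite inE /= in_itv /=; exact: fg. Qed.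

Lemma int01D f g : uc01 f -> uc01 g -> int01 (fun t => f t + g t) = int01 f + int01 g.
Proof. by move=> uf ug; apply: RintegralD => //; exact: uc01_integrable. Qed.

Lemma int01Z c f : uc01 f -> int01 (fun t => c * f t) = c * int01 f.
Proof. by move=> uf; apply: RintegralZl => //; exact: uc01_integrable. Qed.

Lemma int01_cst c : int01 (fun=> c) = c.
Proof.
rewrite /int01 Rintegral_cst //.
rewrite (_ : fine _ = 1) ?mulr1 //.
have := @lebesgue_measure_itv R `[0, 1]; rewrite /= lte01 oppr0 adde0.
exact: (congr1 fine).
Qed.

Lemma le_int01 f g : uc01 f -> uc01 g -> (forall t, 0 <= t <= 1 -> f t <= g t) ->
  int01 f <= int01 g.
Proof.
move=> uf ug fg; by apply: le_Rintegral => //; exact: uc01_integrable.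
Qed.

Lemma int01_dist f g e : uc01 f -> uc01 g ->
  (forall t, 0 <= t <= 1 -> `|f t - g t| <= e) -> `|int01 f - int01 g| <= e.
Proof.
move=> uf ug fg; rewrite ler_distl; apply/andP; split.
  rewrite lerBlDr -[X in _ + X]int01_cst -int01D //; last exact: uc01_cst.
  apply: le_int01 => //; first by apply: uc01D => //; exact: uc01_cst.
  by move=> t /fg; rewrite ler_distlC => /andP[_].
rewrite -[X in _ + X]int01_cst -int01D //; last exact: uc01_cst.
apply: le_int01 => //; first by apply: uc01D => //; exact: uc01_cst.
by move=> t /fg; rewrite ler_distl => /andP[_].
Qed.

End UnitInterval.

Section UnitCube.
Context {R : realType} {d : nat}.
Implicit Types (x y : 'rV[R]_d) (g : 'rV[R]_d -> R).

Definition uccube g := forall e : R, 0 < e -> exists2 del : R, 0 < del &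
  forall x y, cube x -> cube y -> (forall i, `|x ord0 i - y ord0 i| < del) ->
    `|g x - g y| < e.

Lemma cube_compact : compact (@cube R d).
Proof.
have /= := @rV_compact R^o d (fun=> `[0, 1]%classic) (fun=> @segment_compact R 0 1).
congr compact; apply/seteqP; split => x /= xc i; have := xc i; by rewrite /= in_itv.
Qed.

Lemma cube0 : cube (0 : 'rV[R]_d).
Proof. by move=> i; rewrite mxE lexx ler01. Qed.

Lemma cube_upd x k t : cube x -> 0 <= t <= 1 -> cube (upd x k t).
Proof. by move=> xc t01 i; rewrite mxE; case: ifP. Qed.

Lemma within_uccube g : {within @cube R d, continuous g} -> uccube g.
Proof.
move=> cg e e0; have /compact_near_coveringP/near_covering_withinP H := cube_compact.
have := H _ (0^'+ : set_system R)
  (fun del x => forall y, cube y -> (forall i, `|x ord0 i - y ord0 i| < del) ->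
     `|g x - g y| < e) _.
case.
  move=> x xc; move/subspace_continuousP: cg => /(_ x xc) /cvgrPdist_lt /(_ (e / 2)).
  rewrite divr_gt0 // => /(_ isT); rewrite near_withinE => /nbhs_ballP[r /= r0 rH].
  near=> s del => /= sc t tc st.
  have sx : ball x (r / 2) s by near: s; apply: nbhsx_ballx; rewrite divr_gt0.
  have delr : del < r / 2 by near: del; apply: nbhs_right_lt; rewrite divr_gt0.
  have tx : ball x r t.
    split=> // i j; rewrite ord1; have [_ /(_ ord0 j)] := sx; rewrite /ball /= => sxj.
    rewrite (_ : x ord0 j - t ord0 j = (x ord0 j - s ord0 j) + (s ord0 j - t ord0 j)); last by ring.
    by rewrite (le_lt_trans (ler_normD _ _)) // (splitr r) ltrD // (lt_trans (st _)).
  have s2 : ball x r s.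
    by apply: le_ball sx; lra.
  have := rH _ s2 sc; have := rH _ tx tc => /= h1 h2.
  rewrite (_ : g s - g t = (g x - g t) - (g x - g s)); last by ring.
  by rewrite (le_lt_trans (ler_normB _ _)) // (splitr e) ltrD.
move=> r /= r0 rH.
exists (r / 2); first by rewrite divr_gt0.
move=> s t sc tc st; apply: (rH (r / 2)) => //=.
- by rewrite sub0r normrN gtr0_norm ?divr_gt0 //; lra.
- by rewrite divr_gt0.
Unshelve. all: by end_near. Qed.

Lemma uccube_slice g x k : uccube g -> cube x -> uc01 (fun t => g (upd x k t)).
Proof.
move=> ug xc e e0; have [a a0 H] := ug e e0; exists a => // s t s01 t01 st.
apply: H => [||i]; try exact: cube_upd.
by rewrite !mxE; case: ifP => // _; rewrite subrr normr0.
Qed.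

Lemma uccube_cst c : uccube (fun=> c).
Proof. by move=> e e0; exists 1 => // s t _ _ _; rewrite subrr normr0. Qed.

Lemma uccubeD f g : uccube f -> uccube g -> uccube (fun x => f x + g x).
Proof.
move=> uf ug e e0; have e2 : 0 < e / 2 by rewrite divr_gt0.
have [a a0 fa] := uf _ e2; have [b b0 gb] := ug _ e2.
exists (Num.min a b); first by rewrite lt_min a0.
move=> s t s01 t01 st.
rewrite (_ : _ - _ = (f s - f t) + (g s - g t)); last by ring.
rewrite (le_lt_trans (ler_normD _ _)) // (splitr e) ltrD // ?fa ?gb // => i.
- by have := st i; rewrite lt_min => /andP[].
- by have := st i; rewrite lt_min => /andP[].
Qed.

Lemma uccube_bounded g : uccube g -> exists2 B, 0 < B & forall x, cube x -> `|g x| <= B.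
Proof.
move=> ug; have [a a0 H] := ug 1 ltr01.
have /compact_near_coveringP/near_covering_withinP K := cube_compact.
have := K _ (+oo : set_system R) (fun B x => `|g x| <= B) _; case.
  move=> x xc; near=> y B => /= yc.
  have xy : ball x a y by near: y; exact: nbhsx_ballx.
  have h : `|g x - g y| < 1.
    by apply: H => // i; have [_ /(_ ord0 i)] := xy.
  have hB : `|g x| + 1 <= B by near: B; apply: nbhs_pinfty_ge; rewrite num_real.
  apply: le_trans hB; rewrite -lerBlDl; apply: ltW.
  by apply: le_lt_trans h; rewrite distrC; exact: lerB_dist.
move=> B [_ HB]; exists (Num.max 1 (B + 1)); first by rewrite lt_max ltr01.
by move=> x xc; apply: HB => //; rewrite lt_max ltrDl ltr01 orbT.
Unshelve. all: by end_near. Qed.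

Lemma uccubeM f g : uccube f -> uccube g -> uccube (fun x => f x * g x).
Proof.
move=> uf ug.
have [A A0 fA] := uccube_bounded uf; have [B B0 gB] := uccube_bounded ug.
move=> e e0; have eB : 0 < e / 2 / B by rewrite !divr_gt0.
have eA : 0 < e / 2 / A by rewrite !divr_gt0.
have [a a0 fa] := uf _ eB; have [b b0 gb] := ug _ eA.
exists (Num.min a b); first by rewrite lt_min a0.
move=> s t sc tc st.
rewrite (_ : _ - _ = (f s - f t) * g s + f t * (g s - g t)); last by ring.
rewrite (le_lt_trans (ler_normD _ _)) // !normrM.
have h1 : `|f s - f t| < e / 2 / B.
  by apply: fa => // i; have := st i; rewrite lt_min => /andP[].
have h2 : `|g s - g t| < e / 2 / A.
  by apply: gb => // i; have := st i; rewrite lt_min => /andP[].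
rewrite (splitr e) ltrD //.
- rewrite (le_lt_trans (ler_wpM2l _ (gB s sc))) //.
  by rewrite -ltr_pdivlMr.
- rewrite (le_lt_trans (ler_wpM2r _ (fA t tc))) //.
  by rewrite mulrC -ltr_pdivlMr.
Qed.

Lemma uccubeZ c f : uccube f -> uccube (fun x => c * f x).
Proof. by move=> uf; apply: uccubeM => //; exact: uccube_cst. Qed.

Lemma uccubeB f g : uccube f -> uccube g -> uccube (fun x => f x - g x).
Proof.
move=> uf ug; have := uccubeD uf (uccubeZ (-1) ug).
by under [X in uccube X]eq_fun do rewrite mulN1r.
Qed.

Lemma uccube_sum (T : Type) (s : seq T) (P : pred T) (F : T -> 'rV[R]_d -> R) :
  (forall k, uccube (F k)) -> uccube (fun x => \sum_(k <- s | P k) F k x).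
Proof.
move=> uF; elim: s => [|k s IH].
  by under [X in uccube X]eq_fun do rewrite big_nil; exact: uccube_cst.
under [X in uccube X]eq_fun do rewrite big_cons.
by case: (P k) => //; exact: uccubeD.
Qed.

(** [upd] overwrites the same coordinate in both points, so an integration preserves every pair
    [(e, del)]. Uniform continuity is carried along because comparing two integrals requires the
    slices to be integrable. *)
Lemma iter_int_dist_uc j g e del : uccube g ->
  (forall x y, cube x -> cube y -> (forall i, `|x ord0 i - y ord0 i| < del) ->
    `|g x - g y| <= e) -> uccube (iter_int j g) /\
  (forall x y, cube x -> cube y -> (forall i, `|x ord0 i - y ord0 i| < del) ->
    `|iter_int j g x - iter_int j g y| <= e).
Proof.
move=> ug; elim: j e del => [|j IH] e del H; first by split.
have ui : uccube (iter_int j g) by have [] := IH e del H.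
have key (e' del' : R) : (forall x y, cube x -> cube y ->
     (forall i, `|x ord0 i - y ord0 i| < del') ->
       `|iter_int j g x - iter_int j g y| <= e') ->
   forall x y, cube x -> cube y -> (forall i, `|x ord0 i - y ord0 i| < del') ->
    `|iter_int j.+1 g x - iter_int j.+1 g y| <= e'.
  move=> H' x y xc yc xy; apply: int01_dist; try exact: uccube_slice.
  move=> t t01; apply: H'; try exact: cube_upd.
  move=> i; rewrite !mxE; case: ifP => // _; rewrite subrr normr0.
  exact: le_lt_trans (xy i).
split; last by apply: key; have [] := IH e del H.
move=> e' e'0; have [b b0 Hb] := ui (e' / 2) (divr_gt0 e'0 (ltr0n _ 2)).
exists b => // x y xc yc xy.
have : `|iter_int j.+1 g x - iter_int j.+1 g y| <= e' / 2.
  by apply: (key (e' / 2) b) => // ? ? ? ? ?; apply/ltW/Hb.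
by move/le_lt_trans; apply; lra.
Qed.

Lemma uccube_iter_int j g : uccube g -> uccube (iter_int j g).
Proof.
move=> ug; have [b b0 Hb] := ug 1 ltr01.
by have [] := @iter_int_dist_uc j g 1 b ug (fun x y xc yc xy => ltW (Hb x y xc yc xy)).
Qed.

Lemma eq_iter_int j f g x : (forall x, cube x -> f x = g x) -> cube x ->
  iter_int j f x = iter_int j g x.
Proof.
move=> fg; elim: j x => [|j IH] x xc; first exact: fg.
by apply: eq_int01 => t t01; apply: IH; exact: cube_upd.
Qed.

Lemma iter_intD j f g x : uccube f -> uccube g -> cube x ->
  iter_int j (fun x => f x + g x) x = iter_int j f x + iter_int j g x.
Proof.
move=> uf ug; elim: j x => [|j IH] x xc //=.
rewrite -[RHS]int01D; last 2 first.
- by apply: uccube_slice => //; exact: uccube_iter_int.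
- by apply: uccube_slice => //; exact: uccube_iter_int.
by apply: eq_int01 => t t01; apply: IH; exact: cube_upd.
Qed.

Lemma iter_intZ j c g x : uccube g -> cube x ->
  iter_int j (fun x => c * g x) x = c * iter_int j g x.
Proof.
move=> ug; elim: j x => [|j IH] x xc //=.
rewrite -[RHS]int01Z; last by apply: uccube_slice => //; exact: uccube_iter_int.
by apply: eq_int01 => t t01; apply: IH; exact: cube_upd.
Qed.

Lemma iter_int_cst j c x : iter_int j (fun=> c) x = c.
Proof.
elim: j x => [|j IH] x //=; rewrite -[RHS]int01_cst.
by apply: eq_int01 => t t01; exact: IH.
Qed.

Lemma iter_int_sum j (T : Type) (s : seq T) (P : pred T) (F : T -> 'rV[R]_d -> R) x :
  (forall k, uccube (F k)) -> cube x ->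
  iter_int j (fun x => \sum_(k <- s | P k) F k x) x = \sum_(k <- s | P k) iter_int j (F k) x.
Proof.
move=> uF xc; elim: s => [|k s IH].
  under eq_fun do rewrite big_nil.
  by rewrite big_nil iter_int_cst.
under eq_fun do rewrite big_cons.
rewrite big_cons; case: (P k) => //.
by rewrite iter_intD // ?IH //; exact: uccube_sum.
Qed.

Lemma le_iter_int j f g x : uccube f -> uccube g -> cube x ->
  (forall x, cube x -> f x <= g x) -> iter_int j f x <= iter_int j g x.
Proof.
move=> uf ug xc fg; elim: j x xc => [|j IH] x xc; first exact: fg.
apply: le_int01; try by apply: uccube_slice => //; exact: uccube_iter_int.
by move=> t t01; apply: IH; exact: cube_upd.
Qed.

Lemma iter_intB j f g x : uccube f -> uccube g -> cube x ->
  iter_int j (fun x => f x - g x) x = iter_int j f x - iter_int j g x.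
Proof.
move=> uf ug xc; rewrite -[in RHS]mulN1r -iter_intZ // -iter_intD //; last exact: uccubeZ.
by under [in RHS]eq_fun do rewrite mulN1r.
Qed.

Lemma iter_int_dist j f g e x : uccube f -> uccube g -> cube x ->
  (forall x, cube x -> `|f x - g x| <= e) -> `|iter_int j f x - iter_int j g x| <= e.
Proof.
move=> uf ug xc fg; elim: j x xc => [|j IH] x xc; first exact: fg.
apply: int01_dist; try by apply: uccube_slice => //; exact: uccube_iter_int.
by move=> t t01; apply: IH; exact: cube_upd.
Qed.

End UnitCube.

(** * Uniqueness of Fourier coefficients *)

Section Trig.
Context {R : realType}.
Implicit Types (f : R -> R) (m : int).

Lemma cos_prod (a b : R) : cos a * cos b = (cos (a + b) + cos (a - b)) / 2.
Proof. by rewrite cosB cosD; field. Qed.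

Lemma cos_subE (a b : R) : cos (2 * a) - cos (2 * b) = 2 * (sin (b + a) * sin (b - a)).
Proof.
have -> : 2 * a = (b + a) - (b - a) by ring.
have -> : 2 * b = (b + a) + (b - a) by ring.
by rewrite (cosB (b + a)) (cosD (b + a)); ring.
Qed.

Lemma cos2pi_int (m : int) (x : R) : cos (2 * pi * m%:~R + x) = cos x.
Proof.
have pn (n : nat) (y : R) : cos (2 * pi * n%:R + y) = cos y.
  rewrite -[RHS](periodicn (@cosD2pi R) n); congr cos.
  by rewrite -[(pi *+ 2) *+ n]mulr_natr -[pi *+ 2]mulr_natr; ring.
case: m => n; first exact: pn.
by rewrite -(pn n.+1) NegzE mulrNz; congr cos; rewrite addrA -mulrDr subrr mulr0 add0r.
Qed.

(** The difference is twice the product of the sines of [pi * (v + u)] and [pi * (v - u)], and both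
    arguments lie in [0, pi]. *)
Lemma cos2pi_le (u v : R) : 0 <= u -> u <= v -> v <= 1 - u ->
  cos (2 * (pi * v)) <= cos (2 * (pi * u)).
Proof.
move=> u0 uv v1; rewrite -subr_ge0 cos_subE -mulrDr -mulrBr.
have p0 := @pi_ge0 R.
rewrite mulr_ge0 // mulr_ge0 // sin_ge0_pi //; apply/andP; split.
- by rewrite mulr_ge0 //; lra.
- by rewrite ler_piMr //; lra.
- by rewrite mulr_ge0 //; lra.
- by rewrite ler_piMr //; lra.
Qed.

Lemma cos2pi_lt (u v : R) : 0 <= u -> u < v -> v < 1 - u ->
  cos (2 * (pi * v)) < cos (2 * (pi * u)).
Proof.
move=> u0 uv v1; rewrite -subr_gt0 cos_subE -mulrDr -mulrBr.
have p0 := @pi_gt0 R.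
rewrite mulr_gt0 // mulr_gt0 // sin_gt0_pi //; apply/andP; split.
- by rewrite mulr_gt0 //; lra.
- by rewrite gtr_pMr //; lra.
- by rewrite mulr_gt0 //; lra.
- by rewrite gtr_pMr //; lra.
Qed.

Lemma cos2pi_eq1 (m : int) (n : nat) : (0 < n)%N ->
  cos (2 * pi * (m%:~R / n%:R)) = 1 :> R -> (n%:Z %| m)%Z.
Proof.
move=> n0 c1; apply/dvdz_mod0P; apply/eqP; apply: contraTT isT => r0.
have nz : n%:Z != 0 by rewrite eqz_nat -lt0n.
have nR : (0 : R) < n%:R by rewrite ltr0n.
set r := (m %% n%:Z)%Z in r0.
have rge : 0 <= r by rewrite modz_ge0.
have rlt : r < n%:Z by rewrite ltz_pmod.
have rR : (r%:~R : R) / n%:R < 1.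
  by rewrite ltr_pdivrMr // mul1r -[n%:R]/(n%:Z%:~R) ltr_int.
have rR0 : 0 < (r%:~R : R) / n%:R.
  by rewrite divr_gt0 // ltr0z lt_def r0.
have : cos (2 * (pi * ((r%:~R : R) / n%:R))) = 1.
  have E : (m%:~R : R) / n%:R = (m %/ n%:Z)%Z%:~R + r%:~R / n%:R.
    rewrite [in LHS](divz_eq m n) -/r rmorphD /= rmorphM /= mulrDl.
    by rewrite -[X in _ * X / _]/(n%:R) mulfK ?gt_eqF.
  by move: c1; rewrite E mulrDr cos2pi_int [2 * (_ * _)]mulrA.
have := @cos2pi_lt 0 (r%:~R / n%:R) (lexx _) rR0; rewrite subr0 => /(_ rR).
by rewrite !mulr0 cos0 => + h; rewrite h ltxx.
Qed.

(** The free phase covers cosine and sine at once and makes products of waves expand into waves. *)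
Definition wave m (psi t : R) : R := cos (2 * pi * (m%:~R * t) + psi).

Lemma wave_continuous m psi : continuous (wave m psi).
Proof.
move=> t; apply: continuous_comp; last exact: continuous_cos.
apply: cvgD; last exact: cvg_cst.
by do 2 (apply: cvgM; first exact: cvg_cst); exact: cvg_id.
Qed.

Lemma uc01_wave m psi : uc01 (wave m psi).
Proof. by apply: continuous_uc01; exact: wave_continuous. Qed.

Lemma int01_wave m psi : int01 (wave m psi) = if m == 0 then cos psi else 0.
Proof.
case: eqP => [->|/eqP m0].
  rewrite -[RHS]int01_cst; apply: eq_int01 => t _.
  by rewrite /wave mul0r mulr0 add0r.
set a : R := 2 * pi * m%:~R.
have a0 : a != 0.
  by rewrite !mulf_neq0 // ?intr_eq0 // gt_eqF // pi_gt0.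
pose F := fun t : R => a^-1 * sin (a * t + psi).
have dF (t : R) : is_derive t (1 : R) F (wave m psi t).
  have h : is_derive t (1 : R) (fun t : R => a * t + psi) a.
    by apply: is_derive_eq; rewrite addr0 /GRing.scale /= mulr1.
  have h2 := @is_derive1_comp R sin (fun t : R => a * t + psi) t _ _ (is_derive_sin _) h.
  have := @is_deriveZ _ _ _ (sin \o (fun t : R => a * t + psi)) a^-1 t 1 _ h2.
  congr is_derive.
  rewrite /wave /GRing.scale /=; have -> : 2 * pi * (m%:~R * t) = a * t by rewrite /a mulrA.
  by field.
have cF : continuous F.
  move=> t; apply/differentiable_continuous; apply/derivable1_diffP.
  by have [] := dF t.
have := @continuous_FTC2 R (wave m psi) F 0 1 ltr01 _ _ _.
rewrite /int01 /Rintegral => -> /=.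
- rewrite /F mulr1 mulr0 add0r -mulrBr.
  suff -> : sin (a + psi) = sin psi by rewrite subrr mulr0.
  by rewrite -!cosBpihalf -[in LHS]addrA cos2pi_int.
- by apply: continuous_subspaceT; exact: wave_continuous.
- split.
  + by move=> x _; have [] := dF x.
  + by apply: cvg_at_right_filter; exact: cF.
  + by apply: cvg_at_left_filter; exact: cF.
- by move=> x _; rewrite derive1E; have [_ ->] := dF x.
Qed.



Lemma wave_shift (A psi psi' : R) m t :
  (A + wave 1 psi t) * wave m psi' t =
  A * wave m psi' t + (wave (m + 1) (psi' + psi) t / 2 + wave (m - 1) (psi' - psi) t / 2).
Proof.
rewrite mulrDl; congr (_ + _); rewrite /wave mulrC cos_prod mulrDl !rmorphD /= rmorphN /=.
by congr (cos _ / _ + cos _ / _); ring.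
Qed.

(** The interval is viewed as the one-dimensional cube, where products have been treated. *)
Lemma uc01M f (g : R -> R) : uc01 f -> uc01 g -> uc01 (fun t => f t * g t).
Proof.
move=> uf ug; pose F (h : R -> R) (x : 'rV[R]_1) := h (x ord0 ord0).
have uF h : uc01 h -> uccube (F h).
  move=> uh e e0; have [a a0 H] := uh e e0; exists a => // x y xc yc xy.
  by apply: H; [exact: xc | exact: yc | exact: xy].
have := uccube_slice 0 (uccubeM (uF f uf) (uF g ug)) (@cube0 R 1).
by rewrite /F; under [X in uc01 X]eq_fun do rewrite mxE /=.
Qed.

(** Multiplication by [A + wave 1 psi] turns a wave of frequency m into a combination of waves of
    frequencies m, m + 1 and m - 1. Orthogonality to all waves of all phases therefore survives each
    power. *)
Lemma uc01_fourier0 f : uc01 f ->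
  (forall m psi, int01 (fun t => f t * wave m psi t) = 0) ->
  forall A psi N m psi', int01 (fun t => f t * (A + wave 1 psi t) ^+ N * wave m psi' t) = 0.
Proof.
move=> uf f0 A psi; elim=> [|N IH] m psi'.
  by under eq_fun do rewrite expr0 mulr1.
have uN : uc01 (fun t => f t * (A + wave 1 psi t) ^+ N).
  elim: N {IH} => [|N IH]; first by under [X in uc01 X]eq_fun do rewrite expr0 mulr1.
  under [X in uc01 X]eq_fun do rewrite exprSr mulrA.
  by apply: uc01M => //; apply: uc01D; [exact: uc01_cst | exact: uc01_wave].
have uw k p : uc01 (fun t => f t * (A + wave 1 psi t) ^+ N * wave k p t).
  by apply: uc01M => //; exact: uc01_wave.
rewrite (_ : (fun _ => _) = fun t =>
    A * (f t * (A + wave 1 psi t) ^+ N * wave m psi' t) +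
    (2^-1 * (f t * (A + wave 1 psi t) ^+ N * wave (m + 1) (psi' + psi) t) +
     2^-1 * (f t * (A + wave 1 psi t) ^+ N * wave (m - 1) (psi' - psi) t))); last first.
  apply/funext => t; rewrite exprSr mulrA -[LHS]mulrA wave_shift; ring.
rewrite int01D; [|exact: uc01Z|by apply: uc01D; exact: uc01Z].
by rewrite int01D ?int01Z ?IH ?mulr0 ?addr0 //; exact: uc01Z.
Qed.

End Trig.

Section Unique.
Context {R : realType}.
Implicit Types (f g : R -> R).

(** The step function equal to [C - B] on [[a, b]] and to [- B] elsewhere lies below [g]. *)
Lemma int01_bump g (a b B C : R) : uc01 g -> 0 <= a -> a < b -> b <= 1 ->
  (forall t, 0 <= t <= 1 -> - B <= g t) ->
  (forall t, a <= t <= b -> C - B <= g t) -> C * (b - a) - B <= int01 g.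
Proof.
move=> ug a0 ab b1 gB gC.
pose J := `[a, b]%classic : set R.
have JE : `[0, 1]%classic `&` J = J.
  apply/seteqP; split => [t []//|t /= tJ]; split => //.
  move: tJ; rewrite /J /= !in_itv /= => /andP[at_ tb].
  by rewrite (le_trans a0 at_) (le_trans tb b1).
have iJ : (@lebesgue_measure R).-integrable `[0, 1]%classic (EFin \o (cst C \_ J)).
  rewrite -restrict_EFin; apply/integrable_restrict => //; first exact: measurable_itv.
  rewrite JE.
  by apply: continuous_compact_integrable; [exact: segment_compact | move=> x; exact: cvg_cst].
have iB : (@lebesgue_measure R).-integrable `[0, 1]%classic (EFin \o (cst (- B))).
  by apply: uc01_integrable; exact: uc01_cst.
have : \int[@lebesgue_measure R]_(t in `[0, 1]) ((cst C \_ J) t + (cst (- B)) t) <= int01 g.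
  apply: le_Rintegral => //; [|exact: uc01_integrable|].
    exact: (integrableD _ iJ iB).
  move=> t t01; have {}t01 : 0 <= t <= 1 by move: t01; rewrite /= in_itv.
  rewrite patchE; case: ifPn => [/set_mem|_]; last by rewrite add0r; exact: gB.
  by rewrite /J /= in_itv /=; exact: gC.
rewrite RintegralD // -Rintegral_mkcondr JE Rintegral_cst //; last exact: measurable_itv.
rewrite [X in _ + X <= _](int01_cst (- B)).
rewrite (_ : fine _ = b - a) //.
have := @lebesgue_measure_itv R `[a, b]; rewrite /= lte_fin ab -EFinB.
exact: (congr1 fine).
Qed.

(* Lebesgue's argument: the trigonometric polynomial
   T = 1 + cos (2 pi (t - s)) - cos (2 pi delta) exceeds 1 + eta near s and lies
   in [-1, 1] outside |t - s| <= delta, so int f T^N = 0 is violated for N large. *)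
Lemma fourier0_no_bump f (s delta e : R) : uc01 f ->
  (forall m psi, int01 (fun t => f t * wave m psi t) = 0) ->
  0 < e -> 0 < delta -> 0 < s - delta -> s + delta < 1 ->
  ~ (forall t, `|t - s| <= delta -> e <= f t).
Proof.
move=> uf f0 e0 d0 sd0 sd1 fe.
pose psi := - (2 * (pi * s)) : R; pose A := 1 - cos (2 * (pi * delta)).
pose T t := A + wave 1 psi t.
have TE t : T t = 1 + (cos (2 * (pi * `|t - s|)) - cos (2 * (pi * delta))).
  rewrite /T /A /wave /psi mul1r.
  have -> : 2 * pi * t + - (2 * (pi * s)) = 2 * (pi * (t - s)) by ring.
  rewrite -[cos (2 * (pi * (t - s)))]cos_norm !normrM ger0_norm // (ger0_norm (@pi_ge0 R)); ring.
pose eta := cos (2 * (pi * (delta / 2))) - cos (2 * (pi * delta)).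
have eta0 : 0 < eta by rewrite subr_gt0; apply: cos2pi_lt; lra.
have [B B0 fB] : exists2 B, 0 < B & forall t, 0 <= t <= 1 -> `|f t| <= B.
  have uF : uccube (fun x : 'rV[R]_1 => f (x ord0 ord0)).
    move=> e' e'0; have [a a0 H] := uf e' e'0; exists a => // x y xc yc xy.
    by apply: H; [exact: xc | exact: yc | exact: xy].
  have [B B0 HB] := uccube_bounded uF; exists B => // t t01.
  have /HB : cube (\row_(i < 1) t) by move=> i; rewrite mxE.
  by rewrite mxE.
have uT N : uc01 (fun t => T t ^+ N).
  elim: N => [|N IH]; first by under [X in uc01 X]eq_fun do rewrite expr0; exact: uc01_cst.
  under [X in uc01 X]eq_fun do rewrite exprS.
  by apply: uc01M => //; apply: uc01D; [exact: uc01_cst | exact: uc01_wave].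
have out t : 0 <= t <= 1 -> delta <= `|t - s| -> `|T t| <= 1.
  move=> t01 ts; rewrite TE.
  have h : cos (2 * (pi * `|t - s|)) <= cos (2 * (pi * delta)).
    apply: cos2pi_le => //; first exact: ltW.
    by rewrite ler_norml; lra.
  have := cos_geN1 (2 * (pi * `|t - s|)); have := cos_le1 (2 * (pi * delta)).
  by rewrite ler_norml => h1 h2; lra.
have inn t : `|t - s| <= delta -> 1 <= T t.
  move=> ts; rewrite TE lerDl subr_ge0; apply: cos2pi_le => //; lra.
have inner t : `|t - s| <= delta / 2 -> 1 + eta <= T t.
  move=> ts; rewrite TE lerD2l /eta lerD2r; apply: cos2pi_le => //; lra.
(* The bump is the interval of radius delta / 2 around s, where [f * T ^+ N] is at least e (1 +
   eta)^N. Between delta / 2 and delta the product is nonnegative, and farther out [T] is at most 1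
   in absolute value, so the product is at least - B there. *)
have bound N : (e * (1 + eta *+ N) + B) * delta - B <= 0.
  have -> : (0 : R) = int01 (fun t => f t * T t ^+ N).
    rewrite -[LHS](uc01_fourier0 uf f0 A psi N 0 0); apply: eq_int01 => t _.
    by rewrite /wave mul0r mulr0 add0r cos0 mulr1.
  have -> : delta = (s + delta / 2) - (s - delta / 2) by lra.
  apply: int01_bump; [exact: uc01M| lra|lra|lra| |].
  - move=> t t01; have [ts|/ltW ts] := leP `|t - s| delta.
      apply: (@le_trans _ _ 0); first by rewrite oppr_le0 ltW.
      apply: mulr_ge0; first exact: le_trans (ltW e0) (fe _ ts).
      by apply: exprn_ge0; apply: le_trans (inn _ ts).
    apply: le_trans (_ : - `|f t * T t ^+ N| <= _); last by rewrite lerNl -normrN ler_norm.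
    rewrite lerN2 normrM -[leRHS]mulr1 ler_pM ?fB // normrX.
    by apply: exprn_ile1 => //; exact: out.
  - move=> t tJ; have ts : `|t - s| <= delta / 2 by rewrite ler_norml; lra.
    have ts' : `|t - s| <= delta by apply: le_trans ts _; lra.
    rewrite addrK; apply: ler_pM; [exact: ltW| |exact: fe|].
      by rewrite addr_ge0 // mulrn_wge0 // ltW.
    apply: le_trans (_ : (1 + eta) ^+ N <= _); last first.
      by have := inner _ ts; apply: lerXn2r; rewrite nnegrE; have := inner _ ts; lra.
    (* Bernoulli's inequality: growth linear in N is enough for the contradiction. *)
    elim: N {uT} => [|N IH]; first by rewrite mulr0n addr0 expr0.
    rewrite exprS; apply: le_trans (_ : (1 + eta) * (1 + eta *+ N) <= _).
      rewrite mulrS mulrDl mul1r mulrDr mulr1.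
      have : 0 <= eta * eta *+ N by rewrite mulrn_wge0 // mulr_ge0 // ltW.
      by rewrite -mulrnAr; lra.
    by rewrite ler_pM2l //; lra.
have ed : 0 < e * eta * delta by rewrite !mulr_gt0.
have := bound (Num.truncn (B / (e * eta * delta))).+1.
have := truncnS_gt (B / (e * eta * delta)).
set N := _.+1; rewrite ltr_pdivrMr // -[eta *+ N]mulr_natr => h1 h2.
have : 0 < e * delta by rewrite mulr_gt0.
have : 0 < B * delta by rewrite mulr_gt0.
move: h2; have -> : (e * (1 + eta * N%:R) + B) * delta - B =
  e * delta + B * delta + (N%:R * (e * eta * delta) - B) by ring.
lra.
Qed.

Lemma fourier_unique01 f : uc01 f ->
  (forall m psi, int01 (fun t => f t * wave m psi t) = 0) ->
  forall t, 0 <= t <= 1 -> f t = 0.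
Proof.
have pos g : uc01 g -> (forall m psi, int01 (fun t => g t * wave m psi t) = 0) ->
    forall t, 0 <= t <= 1 -> g t <= 0.
  move=> ug g0 t t01; rewrite leNgt; apply/negP => gt0.
  have [a a0 H] := ug (g t / 2) (divr_gt0 gt0 (ltr0n _ 2)).
  pose b := Num.min a (1 / 2).
  have b0 : 0 < b by rewrite /b lt_min a0; lra.
  have ba : b <= a by rewrite /b ge_min lexx.
  have b2 : b <= 1 / 2 by rewrite /b ge_min lexx orbT.
  (* The point t may be an endpoint, while the bump must lie inside (0, 1). Its centre is therefore
     moved by b / 2 towards the middle; with half-width b / 4 it stays within the modulus [a] of
     t. *)
  have main s : 0 < s - b / 4 -> s + b / 4 < 1 -> `|s - t| <= b / 2 -> False.
    move=> s0 s1 st.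
    apply: (@fourier0_no_bump g s (b / 4) (g t / 2)) => //; [lra|lra|] => u us.
    have : `|g u - g t| < g t / 2.
      apply: H => //; first by move: us; rewrite ler_norml; lra.
      by move: us st; rewrite !ler_norml ltr_norml; lra.
    by rewrite ltr_norml; lra.
  have [t2|t2] := leP t (1 / 2).
    by apply: (main (t + b / 2)); [lra|lra|rewrite ler_norml; lra].
  by apply: (main (t - b / 2)); [lra|lra|rewrite ler_norml; lra].
move=> uf f0 t t01; apply/eqP; rewrite eq_le pos //= -oppr_le0.
apply: (pos (fun t => - f t)) => //.
  by under [X in uc01 X]eq_fun do rewrite -mulN1r; exact: uc01Z.
move=> m psi; rewrite (_ : (fun _ => _) = fun t => -1 * (f t * wave m psi t)).
  by rewrite int01Z ?f0 ?mulr0 //; apply: uc01M => //; exact: uc01_wave.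
by apply/funext => u; rewrite mulN1r mulNr.
Qed.

End Unique.

Section CubeFourier.
Context {R : realType} {d : nat}.
Implicit Types (x y : 'rV[R]_d) (g h : 'rV[R]_d -> R) (k l : {ffun 'I_d -> int}).

Lemma kdotD k l x : kdot (k + l) x = kdot k x + kdot l x.
Proof.
by rewrite /kdot -big_split /=; apply: eq_bigr => i _; rewrite ffunE rmorphD /= mulrDl.
Qed.

Lemma kdotN k x : kdot (- k) x = - kdot k x.
Proof.
by rewrite /kdot -sumrN; apply: eq_bigr => i _; rewrite ffunE rmorphN /= mulNr.
Qed.

Lemma kdotB k l x : kdot (k - l) x = kdot k x - kdot l x.
Proof. by rewrite kdotD kdotN. Qed.

Definition pwave k (psi : R) x : R := cos (2 * pi * kdot k x + psi).

Lemma pwave_continuous k psi : continuous (pwave k psi).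
Proof.
have ck : continuous (fun x => kdot k x).
  have ci (i : 'I_d) : continuous (fun x : 'rV[R]_d => (k i)%:~R * x ord0 i).
    move=> x; apply: (@continuousM R _ (fun=> (k i)%:~R) (fun x : 'rV[R]_d => x ord0 i)).
      exact: cst_continuous.
    exact: coord_continuous.
  rewrite /kdot; elim: (index_enum _) => [|i s IH] x.
    by under eq_fun do rewrite big_nil; exact: cst_continuous.
  under eq_fun do rewrite big_cons.
  apply: (@continuousD R R^o _ (fun x : 'rV[R]_d => (k i)%:~R * x ord0 i)); first exact: ci.
  exact: IH.
move=> x; apply: (@continuous_comp _ _ _ (fun x => kdot k x) (fun t => cos (2 * pi * t + psi))).
  exact: ck.
apply: continuous_comp; last exact: continuous_cos.
apply: cvgD; last exact: cvg_cst.
by apply: cvgM; [exact: cvg_cst | exact: cvg_id].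
Qed.

Lemma uccube_pwave k psi : uccube (pwave k psi).
Proof. by apply: within_uccube; apply: continuous_subspaceT; exact: pwave_continuous. Qed.

Lemma kdot_upd k x (i : 'I_d) t : kdot k (upd x i t) = kdot k (upd x i 0) + (k i)%:~R * t.
Proof.
rewrite /kdot (bigD1 i) //= [in RHS](bigD1 i) //= !mxE eqxx mulr0 add0r addrC.
by congr (_ + _); apply: eq_bigr => j ji; rewrite !mxE val_eqE (negbTE ji).
Qed.

Lemma kdot_upd0 k x (i : 'I_d) t : k i = 0 -> kdot k (upd x i t) = kdot k x.
Proof.
move=> ki; apply: eq_bigr => j _; rewrite mxE; case: eqP => // /val_inj ->.
by rewrite ki !mul0r.
Qed.

Lemma iter_int_pwave j k psi x : (j <= d)%N ->
  iter_int j (pwave k psi) x =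
  if [forall i : 'I_d, (i < j)%N ==> (k i == 0)] then pwave k psi x else 0.
Proof.
elim: j x => [|j IH] x jd; first by case: ifPn => // /forallPn[i].
pose i0 := Ordinal jd.
have -> : [forall i : 'I_d, (i < j.+1)%N ==> (k i == 0)] =
    [forall i : 'I_d, (i < j)%N ==> (k i == 0)] && (k i0 == 0).
  apply/forallP/andP => [H|[/forallP H k0] i].
    by split; [apply/forallP => i; apply/implyP => ij; have := H i; rewrite ltnS ltnW|
               have := H i0; rewrite ltnSn].
  rewrite ltnS leq_eqVlt; apply/implyP => /predU1P[ij|ij]; last by have := H i; rewrite ij.
  by rewrite (_ : i = i0) //; apply: val_inj.
rewrite /= -/(int01 _); transitivity (int01 (fun t =>
    if [forall i : 'I_d, (i < j)%N ==> (k i == 0)] then pwave k psi (upd x j t) else 0)).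
  by apply: eq_int01 => t _; rewrite IH // ltnW.
case: [forall _, _] => /=; last exact: int01_cst.
transitivity (int01 (wave (k i0) (2 * pi * kdot k (upd x i0 0) + psi))).
  apply: eq_int01 => t _; rewrite /pwave /wave (kdot_upd k x i0 t); congr cos; ring.
rewrite int01_wave; case: eqP => // ki.
by rewrite /pwave kdot_upd0.
Qed.

Lemma cube_int_pwave k psi : cube_int (pwave k psi) = if k == 0 then cos psi else 0.
Proof.
rewrite /cube_int iter_int_pwave //; case: eqP => [->|/eqP k0].
  rewrite ifT; last by apply/forallP => i; rewrite ffunE eqxx implybT.
  by rewrite /pwave /kdot big1 ?mulr0 ?add0r // => i _; rewrite ffunE mul0r.
rewrite ifF //; apply/negP => /forallP H; move/eqP: k0; apply.
by apply/ffunP => i; have := H i; rewrite ltn_ord ffunE => /eqP.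
Qed.

Lemma iter_int_indep j g x y : (forall i : 'I_d, (j <= i)%N -> x ord0 i = y ord0 i) ->
  iter_int j g x = iter_int j g y.
Proof.
elim: j x y => [|j IH] x y xy /=.
  by congr g; apply/rowP => i; exact: xy.
apply: eq_int01 => t _; apply: IH => i ji; rewrite !mxE; case: eqP => // /eqP ij.
by apply: xy; rewrite ltn_neqAle eq_sym ij.
Qed.

Lemma iter_int_pull j (i : 'I_d) g (w : R -> R) x : (j <= i)%N -> cube x -> uccube g ->
  iter_int j (fun y => g y * w (y ord0 i)) x = iter_int j g x * w (x ord0 i).
Proof.
move=> + xc ug; elim: j x xc => [//|j IH] x xc ji.
rewrite /= mulrC -int01Z; last by apply: uccube_slice => //; exact: uccube_iter_int.
apply: eq_int01 => t t01; rewrite IH ?(ltnW ji) //; last exact: cube_upd.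
by rewrite mulrC mxE gtn_eqF.
Qed.

(* One coordinate is peeled off at a time, starting with the outermost integral:
   for fixed remaining frequencies the inner integral is a continuous function
   of that coordinate all of whose Fourier coefficients vanish. *)
Lemma cube_fourier_unique h : uccube h ->
  (forall k psi, cube_int (fun x => h x * pwave k psi x) = 0) ->
  forall x, cube x -> h x = 0.
Proof.
move=> uh h0.
have uhp k psi : uccube (fun x => h x * pwave k psi x).
  by apply: uccubeM => //; exact: uccube_pwave.
have main m : (m <= d)%N -> forall k psi x, cube x ->
    iter_int (d - m) (fun x => h x * pwave k psi x) x = 0.
  elim: m => [|m IH] md k psi x xc.
    rewrite subn0 -[RHS](h0 k psi); apply: iter_int_indep => i.
    by rewrite leqNgt ltn_ord.
  have jd : (d - m.+1 < d)%N by rewrite ltn_subrL (leq_ltn_trans _ md).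
  set j := (d - m.+1)%N in jd *; pose i0 := Ordinal jd.
  have jE : (d - m)%N = j.+1 by rewrite /j subnSK.
  pose phi t := iter_int j (fun x => h x * pwave k psi x) (upd x j t).
  have uphi : uc01 phi by apply: uccube_slice => //; exact: uccube_iter_int.
  suff phi0 t : 0 <= t <= 1 -> phi t = 0.
    rewrite -(phi0 (x ord0 i0)) //; congr iter_int; apply/rowP => i; rewrite mxE.
    by case: eqP => // ij; congr (x _ _); apply: val_inj.
  move: t; apply: fourier_unique01 => // n psi'.
  pose e := [ffun i => if i == i0 then n else 0] : {ffun 'I_d -> int}.
  have kd y : kdot e y = n%:~R * y ord0 i0.
    rewrite /kdot (bigD1 i0) //= ffunE eqxx big1 ?addr0 // => i /negbTE ii0.
    by rewrite ffunE ii0 mul0r.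
  (* A wave in coordinate j shifts the frequency vector by [e] or [- e] and changes the phase, which
     is why the induction ranges over all [k] and [psi]. *)
  have step : forall t, 0 <= t <= 1 -> phi t * wave n psi' t =
     2^-1 * iter_int j (fun x => h x * pwave (k + e) (psi + psi') x) (upd x j t) +
     2^-1 * iter_int j (fun x => h x * pwave (k - e) (psi - psi') x) (upd x j t).
    move=> t t01; have xc' := @cube_upd R d x j t xc t01.
    have := @iter_int_pull j i0 _ (wave n psi') (upd x j t) (leqnn _) xc' (uhp k psi).
    rewrite mxE eqxx => <-; rewrite -!iter_intZ // -iter_intD //; try exact: uccubeZ.
    apply: eq_iter_int => // y _; rewrite -mulrA /wave /pwave cos_prod kdotB kdotD kd.
    have -> : 2 * pi * (kdot k y + n%:~R * y ord0 i0) + (psi + psi') =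
      2 * pi * kdot k y + psi + (2 * pi * (n%:~R * y ord0 i0) + psi') by ring.
    have -> : 2 * pi * (kdot k y - n%:~R * y ord0 i0) + (psi - psi') =
      2 * pi * kdot k y + psi - (2 * pi * (n%:~R * y ord0 i0) + psi') by ring.
    by ring.
  rewrite (eq_int01 step).
  have us l p : uc01 (fun t => iter_int j (fun x => h x * pwave l p x) (upd x j t)).
    by apply: uccube_slice => //; exact: uccube_iter_int.
  rewrite int01D ?int01Z //; try exact: uc01Z.
  have IH' l p : int01 (fun t => iter_int j (fun x => h x * pwave l p x) (upd x j t)) = 0.
    by have := IH (ltnW md) l p x xc; rewrite jE.
  by rewrite !IH' !mulr0 addr0.
move=> x xc; have := main d (leqnn d) 0 0 x xc; rewrite subnn /= /pwave.
rewrite /kdot big1 ?mulr0 ?add0r ?cos0 ?mulr1 // => i _.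
by rewrite ffunE mul0r.
Qed.

End CubeFourier.

(** * Absolutely convergent Fourier series *)

Lemma esum_ge_seq (R : realType) (T : choiceType) (S : set T) (a : T -> \bar R) (s : seq T) :
  uniq s -> (forall x, x \in s -> S x) -> (\sum_(x <- s) a x <= \esum_(x in S) a x)%E.
Proof.
move=> us sS; apply: esum_ge; exists [set` s]; last by rewrite fsbig_seq.
by split; [exact: finite_seq | move=> x /= /sS].
Qed.

Section Box.
Context {d : nat}.
Implicit Types (k l : {ffun 'I_d -> int}) (N M : nat).

(** The frequencies of maximum norm at most N. The enumeration through finite functions makes a sum
    of coordinatewise products over a box factor into a d-th power. *)
Definition box N : seq {ffun 'I_d -> int} :=
  [seq [ffun i => (m i : nat)%:Z - N%:Z] | m : {ffun 'I_d -> 'I_(N.*2.+1)}].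

Lemma box_uniq N : uniq (box N).
Proof.
rewrite map_inj_uniq ?enum_uniq // => m m' /ffunP mm'; apply/ffunP => i.
by have := mm' i; rewrite !ffunE => H; apply: val_inj => /=; lia.
Qed.

Lemma mem_box N k : (k \in box N) = [forall i, (`|k i| <= N)%N].
Proof.
apply/mapP/forallP => [[m _ ->] i|kN].
  rewrite ffunE; have := ltn_ord (m i); move: (nat_of_ord (m i)) => c.
  by rewrite ltnS -mul2n; lia.
exists ([ffun i => inord `|(k i + N%:Z)%R|%N] : {ffun 'I_d -> 'I_(N.*2.+1)}); first by rewrite mem_enum.
by apply/ffunP => i; have := kN i; rewrite !ffunE; move: (k i) => c cN; rewrite inordK ?ltnS; lia.
Qed.

Lemma box_sub N M : (N <= M)%N -> {subset box N <= box M}.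
Proof.
move=> NM k; rewrite !mem_box => /forallP kN; apply/forallP => i.
exact: leq_trans (kN i) NM.
Qed.

Lemma box_cover k : exists N, forall M, (N <= M)%N -> k \in box M.
Proof.
exists (\max_i `|k i|%N) => M NM; rewrite mem_box; apply/forallP => i.
by apply: leq_trans NM; exact: (leq_bigmax i).
Qed.

Lemma box_sumB (V : zmodType) (F : {ffun 'I_d -> int} -> V) N M : (N <= M)%N ->
  \sum_(k <- box M) F k - \sum_(k <- box N) F k = \sum_(k <- box M | k \notin box N) F k.
Proof.
move=> NM; rewrite (bigID (fun k => k \in box N)) /= -[X in X + _ - _]big_filter.
rewrite (@perm_big _ _ _ _ _ (box N)); first by rewrite addrAC subrr add0r.
apply: uniq_perm; rewrite ?filter_uniq ?box_uniq // => k.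
rewrite mem_filter; case: (boolP (k \in box N)) => //= kN.
by rewrite (box_sub NM).
Qed.

Lemma box_sum_prod (R : comNzRingType) (u : int -> R) N :
  \sum_(k <- box N) \prod_i u (k i) = (\sum_(m < N.*2.+1) u (m%:Z - N%:Z)) ^+ d.
Proof.
rewrite big_map big_enum /= -[in RHS](card_ord d) -prodr_const bigA_distr_bigA /=.
by apply: eq_bigr => m _; apply: eq_bigr => i _; rewrite ffunE.
Qed.

End Box.

Lemma sum_symm_int (V : zmodType) (u : int -> V) N :
  \sum_(m < N.*2.+1) u (m%:Z - N%:Z) = u 0 + \sum_(j < N) (u j.+1%:Z + u (- j.+1%:Z)).
Proof.
elim: N => [|N IH]; first by rewrite big_ord0 big_ord1 /= subrr addr0.
rewrite [in RHS]big_ord_recr /= [in RHS]addrA -IH doubleS big_ord_recl [in LHS]big_ord_recr /=.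
rewrite /bump /= sub0r [LHS]addrC -[LHS]addrA; congr (_ + _).
  by apply: eq_bigr => i _; congr u; lia.
by congr (u _ + _); lia.
Qed.

Section TrigSeries.
Context {R : realType} {d : nat}.
Local Notation K := {ffun 'I_d -> int}.
Implicit Types (x : 'rV[R]_d) (p q a b t : K -> R) (k l : K).

Lemma pwave_cos k x : cos (2 * pi * kdot k x) = pwave k 0 x.
Proof. by rewrite /pwave addr0. Qed.

Lemma pwave_sin k x : sin (2 * pi * kdot k x) = pwave k (- (pi / 2)) x.
Proof. by rewrite /pwave cosBpihalf. Qed.

(** [p] and [q] are cosine and sine coefficients, since the phase [- (pi / 2)] turns a cosine into a
    sine. For complex coefficients a + ib the real part of the series has the pair (a, - b) and the
    imaginary part the pair (b, a). *)
Definition psum p q N x : R :=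
  \sum_(k <- box N) (p k * pwave k 0 x + q k * pwave k (- (pi / 2)) x).

Lemma uccube_psum p q N : uccube (psum p q N).
Proof.
by apply: uccube_sum => k; apply: uccubeD; apply: uccubeZ; exact: uccube_pwave.
Qed.

Lemma uccube_limit (g : 'rV[R]_d -> R) :
  (forall e : R, 0 < e -> exists2 f, uccube f & forall x, cube x -> `|g x - f x| <= e) -> uccube g.
Proof.
move=> H e e0; have e3 : 0 < e / 4 by lra.
have [f uf gf] := H _ e3; have [c c0 Hc] := uf _ e3.
exists c => // x y xc yc xy; have := Hc x y xc yc xy; have := gf x xc; have := gf y yc.
by rewrite !ler_norml !ltr_norml; lra.
Qed.

Definition vanishing (tau : nat -> R) :=
  forall e, 0 < e -> exists N, forall M, (N <= M)%N -> tau M < e.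

(** The Weierstrass test, with the tail of the majorant [t] as error bound. [tau] is fixed before
    [p] and [q], so that real and imaginary parts share it. *)
Lemma trig_series t (C : R) : (forall k, 0 <= t k) ->
  (forall N, \sum_(k <- box N) t k <= C) ->
  exists2 tau, vanishing tau & forall p q, (forall k, `|p k| + `|q k| <= t k) ->
    exists g, forall N x, `|g x - psum p q N x| <= tau N.
Proof.
move=> t0 tC; pose T N := \sum_(k <- box N) t k.
have TM N M : (N <= M)%N -> T N <= T M.
  by move=> NM; rewrite -subr_ge0 box_sumB // sumr_ge0.
have hT : has_sup (range T).
  by split; [exists (T 0%N); exists 0%N | exists C => _ [N _ <-]; exact: tC].
exists (fun N => sup (range T) - T N).
  move=> e e0; have [_ [N _ <-] HN] := sup_adherent e0 hT.
  by exists N => M /TM; lra.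
have supT N : T N <= sup (range T) by apply: sup_upper_bound => //; exists N.
move=> p q pq.
have diff N M x : (N <= M)%N -> `|psum p q M x - psum p q N x| <= T M - T N.
  move=> NM; rewrite /psum !box_sumB //.
  apply: le_trans (ler_norm_sum _ _ _) _; apply: ler_sum => k _.
  apply: le_trans (ler_normD _ _) _; apply: le_trans (pq k).
  by rewrite !normrM lerD // ler_piMr // cos_max.
have sand N M x : psum p q N x - (sup (range T) - T N) <= psum p q M x + (sup (range T) - T M).
  have := supT N; have := supT M; case: (leqP N M) => [NM|/ltnW NM].
    by have := diff _ _ x NM; rewrite ler_norml; lra.
  by have := diff _ _ x NM; rewrite ler_norml; lra.
(* Any two of the intervals [psum N - tail, psum N + tail] meet, so the supremum
   of their left ends lies in all of them; no pointwise limit is needed. *)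
pose L x := range (fun N => psum p q N x - (sup (range T) - T N)).
exists (fun x => sup (L x)) => N x.
have hL : has_sup (L x).
  split; first by exists (psum p q 0 x - (sup (range T) - T 0%N)); exists 0%N.
  by exists (psum p q 0 x + (sup (range T) - T 0%N)) => _ [M _ <-]; exact: sand.
rewrite ler_distl; apply/andP; split.
  by apply: sup_upper_bound => //; exists N.
by apply: sup_le_ub; [case: hL | move=> _ [M _ <-]; exact: sand].
Qed.

Lemma cube_int_psum_pwave p q N l : l \in box N ->
  cube_int (fun x => \sum_(k <- box N) (p k * pwave (k - l) 0 x
     + q k * pwave (k - l) (- (pi / 2)) x)) = p l.
Proof.
move=> lN; rewrite /cube_int iter_int_sum; last 2 first.
- by move=> k; apply: uccubeD; apply: uccubeZ; exact: uccube_pwave.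
- exact: cube0.
have uZ c k psi : uccube (fun x => c * pwave k psi x) by apply: uccubeZ; exact: uccube_pwave.
have E k : iter_int d (fun x => p k * pwave (k - l) 0 x + q k * pwave (k - l) (- (pi / 2)) x) 0 =
    if k == l then p k else 0.
  rewrite iter_intD //; last exact: cube0.
  rewrite !iter_intZ; try exact: uccube_pwave; try exact: cube0.
  rewrite -!/(cube_int _) !cube_int_pwave subr_eq0 cos0 cosN cos_pihalf.
  by case: eqP; rewrite ?mulr1 !mulr0 addr0.
under eq_bigr do rewrite E.
by rewrite (bigD1_seq l) ?box_uniq //= eqxx big1 ?addr0 // => k /negbTE ->.
Qed.

Lemma fourier_psum a b N l : l \in box N ->
  let f := CFun (psum a (fun k => - b k) N) (psum b a N) in
  fourier_re f l = a l /\ fourier_im f l = b l.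
Proof.
move=> lN /=; split.
  rewrite -[RHS](@cube_int_psum_pwave a (fun k => - b k) N l lN).
  congr cube_int; apply/funext => x /=.
  rewrite /psum !mulr_suml -big_split /=; apply: eq_bigr => k _.
  rewrite -!pwave_cos -!pwave_sin kdotB mulrBr cosB sinB; ring.
rewrite -[RHS](@cube_int_psum_pwave b a N l lN).
congr cube_int; apply/funext => x /=.
rewrite /psum !mulr_suml -sumrB /=; apply: eq_bigr => k _.
rewrite -!pwave_cos -!pwave_sin kdotB mulrBr cosB sinB; ring.
Qed.

Lemma fourier_dist (f g : @cfun R d) (e : R) l :
  uccube (Re_f f) -> uccube (Im_f f) -> uccube (Re_f g) -> uccube (Im_f g) ->
  (forall x, cube x -> `|Re_f f x - Re_f g x| <= e) ->
  (forall x, cube x -> `|Im_f f x - Im_f g x| <= e) ->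
  `|fourier_re f l - fourier_re g l| <= 2 * e /\
  `|fourier_im f l - fourier_im g l| <= 2 * e.
Proof.
move=> u1 u2 u3 u4 fg1 fg2.
have uc : uccube (fun x => cos (2 * pi * kdot l x)).
  by under [X in uccube X]eq_fun do rewrite pwave_cos; exact: uccube_pwave.
have us : uccube (fun x => sin (2 * pi * kdot l x)).
  by under [X in uccube X]eq_fun do rewrite pwave_sin; exact: uccube_pwave.
have key u v (c s : R) : `|u| <= e -> `|v| <= e -> `|c| <= 1 -> `|s| <= 1 ->
    `|u * c + v * s| <= 2 * e.
  move=> ue ve c1 s1; rewrite (le_trans (ler_normD _ _)) // !normrM.
  have := ler_pM (normr_ge0 _) (normr_ge0 _) ue c1.
  by have := ler_pM (normr_ge0 _) (normr_ge0 _) ve s1; lra.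
split; apply: iter_int_dist; try exact: cube0.
- by apply: uccubeD; exact: uccubeM.
- by apply: uccubeD; exact: uccubeM.
- move=> x xc; have := key _ _ _ _ (fg1 x xc) (fg2 x xc) (cos_max (2 * pi * kdot l x))
    (sin_max (2 * pi * kdot l x)).
  by congr (`|_| <= _); ring.
- by apply: uccubeB; exact: uccubeM.
- by apply: uccubeB; exact: uccubeM.
- move=> x xc; have := fg1 x xc; rewrite -normrN => fg1'.
  have := key _ _ _ _ (fg2 x xc) fg1' (cos_max (2 * pi * kdot l x))
    (sin_max (2 * pi * kdot l x)).
  by congr (`|_| <= _); ring.
Qed.

(** A single coefficient mixes cosine and sine integrals of the real and imaginary parts. Replacing
    k by - k flips the sign of the sine integrals, so the coefficients at k and - k together
    determine all four. *)
Lemma fourier_unique (f : @cfun R d) : uccube (Re_f f) -> uccube (Im_f f) ->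
  (forall k, fourier_re f k = 0) -> (forall k, fourier_im f k = 0) ->
  forall x, cube x -> Re_f f x = 0 /\ Im_f f x = 0.
Proof.
move=> u1 u2 fr fi.
pose I1 k := cube_int (fun x => Re_f f x * pwave k 0 x).
pose J1 k := cube_int (fun x => Re_f f x * pwave k (- (pi / 2)) x).
pose I2 k := cube_int (fun x => Im_f f x * pwave k 0 x).
pose J2 k := cube_int (fun x => Im_f f x * pwave k (- (pi / 2)) x).
have uM g k psi : uccube g -> uccube (fun x => g x * pwave k psi x).
  by move=> ug; apply: uccubeM => //; exact: uccube_pwave.
have EN k x : pwave (- k) 0 x = pwave k 0 x.
  by rewrite -!pwave_cos kdotN mulrN cosN.
have ENs k x : pwave (- k) (- (pi / 2)) x = - pwave k (- (pi / 2)) x.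
  by rewrite -!pwave_sin kdotN mulrN sinN.
have frE k : fourier_re f k = I1 k + J2 k.
  rewrite /fourier_re; under eq_fun do rewrite pwave_cos pwave_sin.
  by rewrite /cube_int iter_intD //; [exact: uM|exact: uM|exact: cube0].
have fiE k : fourier_im f k = I2 k - J1 k.
  rewrite /fourier_im; under eq_fun do rewrite pwave_cos pwave_sin.
  by rewrite /cube_int iter_intB //; [exact: uM|exact: uM|exact: cube0].
have oppE (g : 'rV[R]_d -> R) k : uccube g -> cube_int (fun x => g x * pwave (- k) (- (pi / 2)) x) =
    - cube_int (fun x => g x * pwave k (- (pi / 2)) x).
  move=> ug; rewrite -[RHS]mulN1r /cube_int -iter_intZ; [|exact: uM|exact: cube0].
  by apply: eq_iter_int => [x _|]; [rewrite ENs mulN1r mulrN|exact: cube0].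
have I1N k : I1 (- k) = I1 k by congr cube_int; apply/funext => x; rewrite EN.
have I2N k : I2 (- k) = I2 k by congr cube_int; apply/funext => x; rewrite EN.
have J1N k : J1 (- k) = - J1 k by exact: oppE.
have J2N k : J2 (- k) = - J2 k by exact: oppE.
have Z k : I1 k = 0 /\ J1 k = 0 /\ I2 k = 0 /\ J2 k = 0.
  have := fr k; have := fr (- k); have := fi k; have := fi (- k).
  by rewrite !frE !fiE I1N I2N J1N J2N; lra.
have ph g k psi : uccube g -> cube_int (fun x => g x * pwave k 0 x) = 0 ->
    cube_int (fun x => g x * pwave k (- (pi / 2)) x) = 0 ->
    cube_int (fun x => g x * pwave k psi x) = 0.
  move=> ug h1 h2; transitivity (cube_int (fun x => cos psi * (g x * pwave k 0 x) -
      sin psi * (g x * pwave k (- (pi / 2)) x))).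
    congr cube_int; apply/funext => x; rewrite -pwave_cos -pwave_sin /pwave cosD; ring.
  rewrite /cube_int iter_intB ?iter_intZ; try exact: cube0; try exact: uM.
  - by rewrite -!/(cube_int _) h1 h2 !mulr0 subr0.
  - by apply: uccubeZ; exact: uM.
  - by apply: uccubeZ; exact: uM.
move=> x xc; split; apply: cube_fourier_unique => // k psi; apply: ph => //;
  by have [? [? []]] := Z k.
Qed.

(** The series converges uniformly to some uniformly continuous pair [g1], [g2]. Its coefficients
    are those of [f], because coefficients depend continuously on the function in the uniform norm;
    uniqueness then identifies the sum with [f]. *)
Lemma fourier_series (f : @cfun R d) t (C : R) : uccube (Re_f f) -> uccube (Im_f f) ->
  (forall k, `|fourier_re f k| + `|fourier_im f k| <= t k) ->
  (forall N, \sum_(k <- box N) t k <= C) ->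
  exists2 tau, vanishing tau & forall N x, cube x ->
    `|Re_f f x - psum (fourier_re f) (fun k => - fourier_im f k) N x| <= tau N /\
    `|Im_f f x - psum (fourier_im f) (fourier_re f) N x| <= tau N.
Proof.
move=> u1 u2 ft tC.
have t0 k : 0 <= t k by apply: le_trans (ft k); exact: addr_ge0.
have [tau tau0 H] := trig_series t0 tC.
have [g1 Hg1] : exists g, forall N x,
    `|g x - psum (fourier_re f) (fun k => - fourier_im f k) N x| <= tau N.
  by apply: H => k; rewrite normrN.
have [g2 Hg2] : exists g, forall N x, `|g x - psum (fourier_im f) (fourier_re f) N x| <= tau N.
  by apply: H => k; rewrite addrC.
have ug g p q : (forall N x, `|g x - psum p q N x| <= tau N) -> uccube g.
  move=> Hg; apply: uccube_limit => e e0; have [N HN] := tau0 e e0.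
  exists (psum p q N); first exact: uccube_psum.
  by move=> x _; apply: le_trans (Hg N x) (ltW (HN _ (leqnn N))).
have ug1 := ug _ _ _ Hg1; have ug2 := ug _ _ _ Hg2.
have coef l : fourier_re (CFun g1 g2) l = fourier_re f l /\
              fourier_im (CFun g1 g2) l = fourier_im f l.
  have small e : 0 < e -> `|fourier_re (CFun g1 g2) l - fourier_re f l| <= 2 * e /\
      `|fourier_im (CFun g1 g2) l - fourier_im f l| <= 2 * e.
    move=> e0; have [N HN] := tau0 e e0; have [N' HN'] := box_cover l.
    pose M := maxn N N'.
    have [<- <-] := @fourier_psum (fourier_re f) (fourier_im f) M l (HN' _ (leq_maxr _ _)).
    apply: fourier_dist => //=; try exact: uccube_psum.
    - by move=> x _; apply: le_trans (Hg1 M x) (ltW (HN _ (leq_maxl _ _))).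
    - by move=> x _; apply: le_trans (Hg2 M x) (ltW (HN _ (leq_maxl _ _))).
  split; apply/eqP; rewrite -subr_eq0 -normr_le0; apply/ler_addgt0Pr => e e0.
    by have [+ _] := small (e / 2) (divr_gt0 e0 (ltr0n _ 2)); lra.
  by have [_ +] := small (e / 2) (divr_gt0 e0 (ltr0n _ 2)); lra.
pose h := CFun (fun x => Re_f f x - g1 x) (fun x => Im_f f x - g2 x).
have uc l : uccube (fun x => cos (2 * pi * kdot l x)).
  by under [X in uccube X]eq_fun do rewrite pwave_cos; exact: uccube_pwave.
have us l : uccube (fun x => sin (2 * pi * kdot l x)).
  by under [X in uccube X]eq_fun do rewrite pwave_sin; exact: uccube_pwave.
have h0 x : cube x -> Re_f h x = 0 /\ Im_f h x = 0.
  apply: fourier_unique => /= [| |k|k]; try exact: uccubeB.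
    have [E _] := coef k; apply/eqP; rewrite -(subrr (fourier_re f k)) -[in X in _ == _ - X]E.
    rewrite -iter_intB; try exact: cube0; try (by apply: uccubeD; exact: uccubeM).
    by apply/eqP; congr cube_int; apply/funext => y /=; ring.
  have [_ E] := coef k; apply/eqP; rewrite -(subrr (fourier_im f k)) -[in X in _ == _ - X]E.
  rewrite -iter_intB; try exact: cube0; try (by apply: uccubeB; exact: uccubeM).
  by apply/eqP; congr cube_int; apply/funext => y /=; ring.
exists tau => // N x xc; have [/= /subr0_eq -> /subr0_eq ->] := h0 x xc.
by split.
Qed.

End TrigSeries.

(** * Error of the shifted lattice rule *)

Section LatticeSums.
Context {R : realType}.

(** A real substitute for the geometric series. The sum, as a function [C] of the phase, is
    unchanged when the phase moves by [th], by telescoping over full periods. But C (phi + th) + C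
    (phi - th) equals 2 cos th C phi, so [C] vanishes unless cos th = 1, that is, unless n divides
    m. *)
Lemma sum_cos_progression (n : nat) (m : int) (phi : R) : (0 < n)%N ->
  \sum_(j < n) cos (2 * pi * (m%:~R * j%:R / n%:R) + phi) =
  if (n%:Z %| m)%Z then n%:R * cos phi else 0.
Proof.
move=> n0; have nR : (n%:R : R) != 0 by rewrite pnatr_eq0 -lt0n.
case: ifPn => [/dvdzP[q ->]|ndvd].
  rewrite (eq_bigr (fun=> cos phi)); first by rewrite sumr_const card_ord mulr_natl.
  move=> j _; rewrite -[in RHS](cos2pi_int (q * j%:Z)) ; congr (cos (_ * _ + _)).
  by rewrite !rmorphM /= -[n%:~R]/(n%:R) -[j%:~R]/(j%:R); field.
pose th : R := 2 * pi * (m%:~R / n%:R).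
pose C psi := \sum_(j < n) cos (th * j%:R + psi).
have CE psi : C (psi + th) = C psi.
  apply/eqP; rewrite -subr_eq0 /C -sumrB.
  have -> : \sum_(i < n) (cos (th * i%:R + (psi + th)) - cos (th * i%:R + psi)) =
      \sum_(0 <= i < n) (cos (th * i.+1%:R + psi) - cos (th * i%:R + psi)).
    rewrite big_mkord; apply: eq_bigr => i _; congr (cos _ - _).
    by rewrite -natr1; ring.
  rewrite telescope_sumr // mulr0 add0r.
  have -> : th * n%:R = 2 * pi * m%:~R by rewrite /th; field.
  by rewrite cos2pi_int subrr.
have -> : \sum_(j < n) cos (2 * pi * (m%:~R * j%:R / n%:R) + phi) = C phi.
  by apply: eq_bigr => j _; congr cos; rewrite /th; field.
have : C (phi + th) + C (phi - th) = 2 * cos th * C phi.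
  rewrite /C -big_split /= mulr_sumr; apply: eq_bigr => j _.
  rewrite addrA (addrA _ phi (- th)) cosB (cosD (_ + phi)); ring.
rewrite CE; have -> : C (phi - th) = C phi by rewrite -(CE (phi - th)) subrK.
have c1 : cos th != 1 by apply: contraNneq ndvd => /cos2pi_eq1; apply.
move=> H; have : (1 - cos th) * C phi = 0 by lra.
by move/eqP; rewrite mulf_eq0 subr_eq0 eq_sym (negbTE c1) /= => /eqP.
Qed.

Lemma frac_itv (x : R) : 0 <= Defs.frac x < 1.
Proof.
have /andP[a b] := Num.Theory.floor_itv x; move: b; rewrite intrD /Defs.frac => b.
by apply/andP; split; lra.
Qed.

End LatticeSums.

Section Symmetrization.
Context {R : realType} {d : nat}.
Local Notation K := {ffun 'I_d -> int}.
Implicit Types (x : 'rV[R]_d) (k : K) (P : {perm 'I_d}) (I : {set 'I_d}).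

(** The inverse makes this action adjoint to [permx] with respect to [kdot]. *)
Definition kact P k : K := [ffun j => k ((P^-1)%g j)].

Lemma kdot_permx k P x : kdot k (permx P x) = kdot (kact P k) x.
Proof.
rewrite /kdot [RHS](reindex_inj (@perm_inj _ P)) /=; apply: eq_bigr => i _.
by rewrite ffunE mxE permK.
Qed.

Lemma pwave_permx k psi P x : pwave k psi (permx P x) = pwave (kact P k) psi x.
Proof. by rewrite /pwave kdot_permx. Qed.

Lemma cube_permx P x : cube x -> cube (permx P x).
Proof. by move=> xc i; rewrite mxE. Qed.

Lemma Sset_gt0 (u I : {set 'I_d}) : (0 < #|Sset u I|)%N.
Proof. by apply/card_gt0P; exists 1%g; rewrite inE perm_on1. Qed.

Lemma pwave_frac k psi x : pwave k psi (\row_i Defs.frac (x ord0 i)) = pwave k psi x.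
Proof.
pose m : int := \sum_i k i * Num.floor (x ord0 i).
have E : kdot k (\row_i Defs.frac (x ord0 i)) = kdot k x - m%:~R.
  rewrite /kdot /m rmorph_sum /= -sumrB; apply: eq_bigr => i _.
  by rewrite mxE /Defs.frac rmorphM /= mulrBr.
rewrite /pwave E -[LHS](cos2pi_int m); congr cos; ring.
Qed.

End Symmetrization.

Section CubatureError.
Context {R : realType} {d : nat}.
Variables (n : nat) (z : 'I_d -> nat) (Delta : 'rV[R]_d).
Hypothesis n0 : (0 < n)%N.
Local Notation K := {ffun 'I_d -> int}.
Implicit Types (x : 'rV[R]_d) (g : 'rV[R]_d -> R) (k : K) (P : {perm 'I_d}) (I : {set 'I_d}).

Definition cuberr g : R := cube_int g - n%:R^-1 * \sum_(j < n) g (lat_pt n z Delta j).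

Lemma cube_lat_pt j : cube (lat_pt n z Delta j).
Proof. by move=> i; rewrite mxE; have /andP[-> /ltW] := frac_itv (j%:R * (z i)%:R / n%:R + Delta ord0 i). Qed.

Lemma cuberrD g g' : uccube g -> uccube g' -> cuberr (fun x => g x + g' x) = cuberr g + cuberr g'.
Proof.
move=> ug ug'; rewrite /cuberr /cube_int iter_intD //; last exact: cube0.
rewrite big_split /=; ring.
Qed.

Lemma cuberrZ c g : uccube g -> cuberr (fun x => c * g x) = c * cuberr g.
Proof.
move=> ug; rewrite /cuberr /cube_int iter_intZ //; last exact: cube0.
rewrite -mulr_sumr; ring.
Qed.

Lemma cuberr_sum (T : Type) (s : seq T) (Q : pred T) (F : T -> 'rV[R]_d -> R) :
  (forall t, uccube (F t)) ->
  cuberr (fun x => \sum_(t <- s | Q t) F t x) = \sum_(t <- s | Q t) cuberr (F t).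
Proof.
move=> uF; rewrite /cuberr /cube_int iter_int_sum //; last exact: cube0.
by rewrite sumrB -mulr_sumr exchange_big.
Qed.

Lemma cuberr_dist g g' (e : R) : uccube g -> uccube g' ->
  (forall x, cube x -> `|g x - g' x| <= e) -> `|cuberr g - cuberr g'| <= 2 * e.
Proof.
move=> ug ug' gg'.
have nR : (0 : R) < n%:R by rewrite ltr0n.
have h1 : `|cube_int g - cube_int g'| <= e by apply: iter_int_dist => //; exact: cube0.
have h2 : `|n%:R^-1 * \sum_(j < n) g (lat_pt n z Delta j) -
            n%:R^-1 * \sum_(j < n) g' (lat_pt n z Delta j)| <= e.
  rewrite -mulrBr normrM gtr0_norm ?invr_gt0 // mulrC ler_pdivrMr // -sumrB.
  apply: le_trans (ler_norm_sum _ _ _) _.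
  rewrite -[n in _ * n%:R]card_ord mulr_natr -sumr_const.
  by apply: ler_sum => j _; apply: gg'; exact: cube_lat_pt.
by move: h1 h2; rewrite /cuberr !ler_norml; lra.
Qed.

(** Zero always lies in the dual lattice but is left out because constants are integrated
    exactly. *)
Definition dualnz k : bool := (k != 0) && in_dual n z [set: 'I_d]%SET k.

Lemma cuberr_pwave k psi : cuberr (pwave k psi) = - ((dualnz k)%:R * pwave k psi Delta).
Proof.
have nR : (n%:R : R) != 0 by rewrite pnatr_eq0 -lt0n.
pose m : int := \sum_(j in [set: 'I_d]%SET) k j * (z j)%:Z.
have -> : cuberr (pwave k psi) = cube_int (pwave k psi) -
    (if in_dual n z [set: 'I_d]%SET k then pwave k psi Delta else 0).
  congr (_ - _); rewrite (eq_bigr (fun j : 'I_n =>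
      cos (2 * pi * (m%:~R * j%:R / n%:R) + (2 * pi * kdot k Delta + psi)))).
    rewrite sum_cos_progression // /in_dual -/m; case: ifP => _; last by rewrite mulr0.
    by rewrite mulrA mulVf // mul1r.
  move=> j _; have -> : lat_pt n z Delta j = \row_i Defs.frac
      ((\row_i (j%:R * (z i)%:R / n%:R + Delta ord0 i) : 'rV[R]_d) ord0 i).
    by apply/rowP => i; rewrite !mxE.
  rewrite pwave_frac /pwave addrA -mulrDr; congr (cos (_ * _ + _)).
  have -> : m = \sum_i k i * (z i)%:Z by apply: eq_bigl => i; rewrite inE.
  rewrite /kdot rmorph_sum /= !mulr_suml -big_split /=.
  apply: eq_bigr => i _; rewrite mxE rmorphM /= -[(z i)%:~R]/((z i)%:R); ring.
rewrite cube_int_pwave /dualnz; case: eqP => [->|_] /=.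
  rewrite /in_dual big1; last by move=> i _; rewrite ffunE mul0r.
  rewrite dvdz0 mul0r oppr0 /pwave /kdot big1 ?mulr0 ?add0r ?subrr // => i _.
  by rewrite ffunE mul0r.
by case: in_dual; rewrite ?mul1r ?mul0r sub0r.
Qed.

(** Minus the average of the cubature errors of [pwave k psi] composed with the admissible
    permutations. *)
Definition symcoef I psi k : R :=
  #|Sset [set: 'I_d]%SET I|%:R^-1 *
  \sum_(P in Sset [set: 'I_d]%SET I) (dualnz (kact P k))%:R * pwave (kact P k) psi Delta.

(* Averaging the expansions of the functions g o P replaces the invariance of the
   Fourier coefficients under permutations, which would require Fubini's theorem
   for iterated integrals. *)
Lemma cuberr_sym I (g : 'rV[R]_d -> R) (p q : K -> R) N (e : R) : uccube g ->
  (forall P, P \in Sset [set: 'I_d]%SET I -> forall x, cube x -> g x = g (permx P x)) ->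
  (forall x, cube x -> `|g x - psum p q N x| <= e) ->
  `|cuberr g - \sum_(k <- box N) (p k * - symcoef I 0 k + q k * - symcoef I (- (pi / 2)) k)|
    <= 2 * e.
Proof.
move=> ug gP gN; set S := Sset _ _ in gP *; set s : R := #|S|%:R.
have s0 : 0 < s by rewrite ltr0n Sset_gt0.
pose F P k x : R := p k * pwave (kact P k) 0 x + q k * pwave (kact P k) (- (pi / 2)) x.
have uF P k : uccube (F P k) by apply: uccubeD; apply: uccubeZ; exact: uccube_pwave.
pose G x := s^-1 * \sum_(P in S) \sum_(k <- box N) F P k x.
have uG1 P : uccube (fun x => \sum_(k <- box N) F P k x) by exact: uccube_sum.
have uG2 : uccube (fun x => \sum_(P in S) \sum_(k <- box N) F P k x) by exact: uccube_sum.
have uG : uccube G by exact: uccubeZ.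
have -> : \sum_(k <- box N) (p k * - symcoef I 0 k + q k * - symcoef I (- (pi / 2)) k) = cuberr G.
  rewrite cuberrZ // cuberr_sum //.
  have -> : \sum_(P in S) cuberr (fun x => \sum_(k <- box N) F P k x) =
     \sum_(k <- box N) \sum_(P in S) cuberr (F P k).
    by rewrite exchange_big /=; apply: eq_bigr => P _; rewrite cuberr_sum.
  rewrite mulr_sumr; apply: eq_bigr => k _; rewrite /symcoef -/S -/s.
  set A := \sum_(P in S) _; set B := \sum_(P in S) _; set D := \sum_(P in S) _.
  have -> : p k * - (s^-1 * A) + q k * - (s^-1 * B) = s^-1 * - (p k * A + q k * B) by ring.
  congr (_ * _); rewrite /A /B /D !mulr_sumr -big_split -sumrN /=; apply: eq_bigr => P _.
  rewrite /F cuberrD ?cuberrZ ?cuberr_pwave; try exact: uccube_pwave;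
    try (by apply: uccubeZ; exact: uccube_pwave).
  ring.
apply: cuberr_dist => // x xc.
have -> : g x - G x = s^-1 * \sum_(P in S) (g (permx P x) - psum p q N (permx P x)).
  rewrite sumrB mulrBr; congr (_ - _).
    rewrite (eq_bigr (fun=> g x)); last by move=> P PS; rewrite -gP.
    by rewrite sumr_const -[_ *+ _]mulr_natr mulrCA mulVf ?mulr1 // gt_eqF.
  congr (_ * _); apply: eq_bigr => P _; apply: eq_bigr => k _.
  by rewrite !pwave_permx.
rewrite normrM gtr0_norm ?invr_gt0 // mulrC ler_pdivrMr //.
apply: le_trans (ler_norm_sum _ _ _) _.
rewrite /s mulr_natr -sumr_const; apply: ler_sum => P PS.
by apply: gN; exact: cube_permx.
Qed.

End CubatureError.

(** * Cauchy-Schwarz and the error bound for a fixed shift *)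

Section CauchySchwarz.
Context {R : realType} {T : Type}.
Implicit Types (s : seq T) (a b p q r : T -> R).

(* In complex notation, with c = a + ib and w = p + iq:
   |sum c w|^2 <= sum |w|^2 / r whenever sum |c|^2 r <= 1. *)
Lemma weighted_cauchy_schwarz s a b p q r : (forall k, 0 < r k) ->
  \sum_(k <- s) (a k ^+ 2 + b k ^+ 2) * r k <= 1 ->
  (\sum_(k <- s) (a k * p k - b k * q k)) ^+ 2 +
  (\sum_(k <- s) (b k * p k + a k * q k)) ^+ 2 <=
  \sum_(k <- s) (p k ^+ 2 + q k ^+ 2) / r k.
Proof.
move=> r0 ab1; set U := \sum_(k <- s) (a k * p k - _); set V := \sum_(k <- s) (b k * p k + _).
set X := U ^+ 2 + V ^+ 2.
have G0 : 0 <= \sum_(k <- s) (p k ^+ 2 + q k ^+ 2) / r k.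
  by apply: sumr_ge0 => k _; rewrite divr_ge0 ?addr_ge0 ?sqr_ge0 // ltW.
have X0 : 0 <= X by rewrite addr_ge0 // sqr_ge0.
have [X00|Xn0] := eqVneq X 0; first by rewrite X00.
have Xp : 0 < X by rewrite lt_def Xn0.
have XE : X = \sum_(k <- s) (a k * (U * p k + V * q k) + b k * (V * p k - U * q k)).
  rewrite /X !expr2.
  have -> : U * U = \sum_(k <- s) U * (a k * p k - b k * q k) by rewrite -mulr_sumr.
  have -> : V * V = \sum_(k <- s) V * (b k * p k + a k * q k) by rewrite -mulr_sumr.
  by rewrite -big_split /=; apply: eq_bigr => k _; ring.
(* Arithmetic-geometric mean term by term, scaled by [X] itself: the gap between the two sides is a
   sum of two squares over [2 * X * r k]. Since the weighted norm is at most 1, summation gives X <=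
   X / 2 + G / 2 for the right-hand side G of the claim, without square roots. *)
have : X <= \sum_(k <- s) (X / 2 * ((a k ^+ 2 + b k ^+ 2) * r k) +
                           2^-1 * ((p k ^+ 2 + q k ^+ 2) / r k)).
  rewrite {1}XE; apply: ler_sum => k _.
  have rk := r0 k; rewrite -subr_ge0.
  have -> : X / 2 * ((a k ^+ 2 + b k ^+ 2) * r k) + 2^-1 * ((p k ^+ 2 + q k ^+ 2) / r k) -
     (a k * (U * p k + V * q k) + b k * (V * p k - U * q k)) =
     (2 * X * r k)^-1 * ((a k * X * r k - (U * p k + V * q k)) ^+ 2 +
                     (b k * X * r k - (V * p k - U * q k)) ^+ 2).
    move: Xn0; rewrite /X => Xn0; field.
    by rewrite Xn0 gt_eqF.
  by rewrite mulr_ge0 ?addr_ge0 ?sqr_ge0 // invr_ge0 mulr_ge0 ?mulr_ge0 // ltW.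
rewrite big_split /= -!mulr_sumr => h.
have h2 : X / 2 * (\sum_(k <- s) (a k ^+ 2 + b k ^+ 2) * r k) <= X / 2.
  by rewrite ler_piMr //; lra.
lra.
Qed.

End CauchySchwarz.

Section Weights.
Context {R : realType} {d : nat}.
Variables (Rf : R -> R) (alpha beta0 beta1 : R).
Hypotheses (HRpos : forall x : R, 1 <= x -> 0 < Rf x) (Hb0 : 0 < beta0) (Hb1 : 0 < beta1).
Local Notation K := {ffun 'I_d -> int}.
Implicit Types (k h : K) (u I : {set 'I_d}).
Local Notation r := (@r_ab R d Rf alpha beta0 beta1).

Lemma powR_absz_gt0 (m : int) (c : R) : m != 0 -> 0 < Rf (absz m)%:R `^ c.
Proof. by move=> m0; rewrite powR_gt0 // HRpos // ler1n lt0n absz_eq0. Qed.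

Lemma r_ab_gt0 u h : 0 < r u h.
Proof.
apply: prodr_gt0 => l _; case: ifPn => [_|h0]; first by rewrite invr_gt0.
by rewrite mulr_gt0 ?invr_gt0 // powR_absz_gt0.
Qed.

Definition coord_weight (m : int) : R :=
  if m == 0 then beta0 else beta1 * Rf (absz m)%:R `^ (- (2 * alpha)).

Lemma coord_weight_gt0 m : 0 < coord_weight m.
Proof. by rewrite /coord_weight; case: ifPn => // m0; rewrite mulr_gt0 // powR_absz_gt0. Qed.

Lemma r_ab_inv u h : (r u h)^-1 = \prod_(l in u) coord_weight (h l).
Proof.
rewrite /r_ab -prodfV; apply: eq_bigr => l _; rewrite /coord_weight.
by case: ifP => _; rewrite ?invrK // invfM invrK powRN.
Qed.

(** The sum over a box is the d-th power of a one-dimensional sum. There zero contributes [beta0],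
    and each pair m, - m contributes twice [beta1] times a term of mu. *)
Lemma sum_r_inv_bounded :
  (\esum_(m in [set m : nat | (0 < m)%N]) (Rf m%:R `^ (- (2 * alpha)))%:E < +oo)%E ->
  exists C, forall N, \sum_(k <- box N) (r [set: 'I_d]%SET k)^-1 <= C.
Proof.
set mu := (\esum_(m in _) _)%E => mufin.
have mu0 : (0 <= mu)%E by apply: esum_ge0 => m _; rewrite lee_fin powR_ge0.
have muE : mu = (fine mu)%:E by rewrite fineK // ge0_fin_numE.
exists ((beta0 + 2 * beta1 * fine mu) ^+ d) => N.
rewrite (eq_bigr (fun k => \prod_i coord_weight (k i))); last first.
  by move=> k _; rewrite r_ab_inv; apply: eq_bigl => l; rewrite inE.
rewrite box_sum_prod.
have w0 m : 0 <= coord_weight m by rewrite ltW // coord_weight_gt0.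
have b0 : 0 <= beta0 + 2 * beta1 * fine mu.
  by rewrite addr_ge0 ?mulr_ge0 ?fine_ge0 // ltW.
apply: lerXn2r; rewrite ?nnegrE ?sumr_ge0 //.
rewrite sum_symm_int {1}/coord_weight eqxx lerD2l.
have -> : \sum_(j < N) (coord_weight j.+1%:Z + coord_weight (- j.+1%:Z)) =
    2 * beta1 * \sum_(j < N) Rf j.+1%:R `^ (- (2 * alpha)).
  rewrite mulr_sumr; apply: eq_bigr => j _.
  by rewrite /coord_weight oppr_eq0 abszN /=; ring.
rewrite ler_wpM2l ?mulr_ge0 ?(ltW Hb1) // -lee_fin -muE -sumEFin.
have := @esum_ge_seq R nat [set m | (0 < m)%N] (fun m => (Rf m%:R `^ (- (2 * alpha)))%:E)
  [seq j.+1 | j <- index_iota 0 N].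
rewrite big_map big_mkord; apply.
  by rewrite map_inj_uniq ?iota_uniq // => i j [].
by move=> x /mapP[j _ ->].
Qed.

Lemma Fnorm2_box (f : @cfun R d) (x : R) N :
  (Fnorm2 Rf alpha beta0 beta1 f <= x%:E)%E ->
  \sum_(k <- box N) (fourier_re f k ^+ 2 + fourier_im f k ^+ 2) * r [set: 'I_d]%SET k <= x.
Proof.
move=> fx; rewrite -lee_fin -sumEFin; apply: le_trans fx.
by apply: esum_ge_seq => //; exact: box_uniq.
Qed.

(** Cauchy-Schwarz is applied on a finite box only, so [M] and [C] need to bound partial sums and no
    infinite sum is rearranged. The truncation error is absorbed by an arbitrary tolerance. *)
Lemma cubature_err_le I n (z : 'I_d -> nat) (Delta : 'rV[R]_d) (M C : R) (f : @cfun R d) :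
  (0 < n)%N ->
  (forall N, \sum_(k <- box N) (r [set: 'I_d]%SET k)^-1 <= C) ->
  (forall N, \sum_(k <- box N) (symcoef n z Delta I 0 k ^+ 2 +
     symcoef n z Delta I (- (pi / 2)) k ^+ 2) / r [set: 'I_d]%SET k <= M) ->
  in_SFd Rf alpha beta0 beta1 I f -> (Fnorm2 Rf alpha beta0 beta1 f <= 1)%E ->
  cubature_err n z Delta f <= Num.sqrt M.
Proof.
move=> n0 rC GM [[c1 [c2 _]] fP] f1.
have u1 : uccube (Re_f f) by exact: within_uccube.
have u2 : uccube (Im_f f) by exact: within_uccube.
set T := [set: 'I_d]%SET in rC GM *.
pose a := fourier_re f; pose b := fourier_im f.
(* From 2 |a| <= a^2 r + 1 / r and the same for b: a majorant whose sum is controlled by the norm of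
   [f] and the sum of 1 / r. *)
pose t k := 2^-1 * ((a k ^+ 2 + b k ^+ 2) * r T k + 2 * (r T k)^-1).
have abt k : `|a k| + `|b k| <= t k.
  have rk := r_ab_gt0 T k; rewrite -subr_ge0.
  have -> : t k - (`|a k| + `|b k|) =
     (2 * r T k)^-1 * ((`|a k| * r T k - 1) ^+ 2 + (`|b k| * r T k - 1) ^+ 2).
    by rewrite /t -(real_normK (num_real (a k))) -(real_normK (num_real (b k))); field;
       rewrite gt_eqF.
  by rewrite mulr_ge0 ?addr_ge0 ?sqr_ge0 // invr_ge0 mulr_ge0 // ltW.
have tC N : \sum_(k <- box N) t k <= 2^-1 * (1 + 2 * C).
  rewrite /t -mulr_sumr big_split /= -mulr_sumr ler_wpM2l // lerD ?ler_wpM2l //.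
  exact: Fnorm2_box.
have [tau tau0 Htau] := fourier_series u1 u2 abt tC.
have symP P : P \in Sset T I -> forall x, cube x ->
    Re_f f x = Re_f f (permx P x) /\ Im_f f x = Im_f f (permx P x).
  by rewrite inE finset.setTI => PI x xc; exact: fP.
pose A k := - symcoef n z Delta I 0 k; pose B k := - symcoef n z Delta I (- (pi / 2)) k.
pose eR := cuberr n z Delta (Re_f f); pose eI := cuberr n z Delta (Im_f f).
rewrite /cubature_err -/(cuberr n z Delta (Re_f f)) -/(cuberr n z Delta (Im_f f)) -/eR -/eI.
apply: ler_wsqrtr; apply/ler_addgt0Pr => e e0.
have D0 : 0 < 2 * `|eR| + 2 * `|eI| + 6.
  by have := normr_ge0 eR; have := normr_ge0 eI; lra.
(* Replacing [eR] and [eI] by approximations within [del] costs del (2 |eR| + 3) and del (2 |eI| +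
   3) in the squares, which together must not exceed e. *)
pose del := Num.min 1 (e / (2 * `|eR| + 2 * `|eI| + 6)).
have del0 : 0 < del by rewrite lt_min ltr01 divr_gt0.
have del1 : del <= 1 by rewrite ge_min lexx.
have dele : del * (2 * `|eR| + 2 * `|eI| + 6) <= e.
  by rewrite -ler_pdivlMr // ge_min lexx orbT.
have [N HN] := tau0 (del / 2) (divr_gt0 del0 (ltr0n _ 2)).
have tauN := HN N (leqnn N).
pose eRN := \sum_(k <- box N) (a k * A k - b k * B k).
pose eIN := \sum_(k <- box N) (b k * A k + a k * B k).
have h1 : `|eR - eRN| <= del.
  apply: (@le_trans _ _ (2 * tau N)); last by lra.
  have -> : eRN = \sum_(k <- box N) (a k * A k + (- b k) * B k).
    by apply: eq_bigr => k _; rewrite mulNr.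
  apply: cuberr_sym => //; first by move=> P PS x xc; have [] := symP P PS x xc.
  by move=> x xc; have [] := Htau N x xc.
have h2 : `|eI - eIN| <= del.
  apply: (@le_trans _ _ (2 * tau N)); last by lra.
  apply: cuberr_sym => //; first by move=> P PS x xc; have [] := symP P PS x xc.
  by move=> x xc; have [] := Htau N x xc.
have h3 : eRN ^+ 2 + eIN ^+ 2 <= M.
  apply: le_trans (GM N); rewrite /eRN /eIN.
  have := weighted_cauchy_schwarz A B (r_ab_gt0 T) (Fnorm2_box N f1).
  move=> /le_trans; apply; apply: ler_sum => k _.
  by rewrite /A /B !sqrrN.
have sq (u v : R) : `|u - v| <= del -> u ^+ 2 <= v ^+ 2 + del * (2 * `|u| + 3).
  move=> uv; have -> : v ^+ 2 = u ^+ 2 - (u - v) * (2 * u) + (u - v) ^+ 2 by ring.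
  have : (u - v) * (2 * u) <= del * (2 * `|u|).
    apply: le_trans (ler_norm _) _; rewrite !normrM (ger0_norm (ler0n _ 2)).
    by rewrite ler_wpM2r // mulr_ge0.
  have := sqr_ge0 (u - v); have : 0 < del * 3 by lra.
  by rewrite mulrDr; lra.
by have := sq _ _ h1; have := sq _ _ h2; lra.
Qed.

End Weights.

(** * Averaging over the shift *)

Section Shift.
Context {R : realType} {d : nat}.
Variables (Rf : R -> R) (alpha beta0 beta1 : R).
Hypotheses (HRpos : forall x : R, 1 <= x -> 0 < Rf x) (Hb0 : 0 < beta0) (Hb1 : 0 < beta1).
Variables (n : nat) (z : 'I_d -> nat) (I : {set 'I_d}).
Local Notation K := {ffun 'I_d -> int}.
Implicit Types (k h : K) (x : 'rV[R]_d) (P Q : {perm 'I_d}).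
Local Notation r := (@r_ab R d Rf alpha beta0 beta1 [set: 'I_d]%SET).
Local Notation S := (Sset [set: 'I_d]%SET I).

Lemma kact_inj P : injective (kact P).
Proof.
move=> k l /ffunP kl; apply/ffunP => i.
by have := kl (P i); rewrite !ffunE permK.
Qed.

Lemma r_kact P k : r (kact P k) = r k.
Proof.
rewrite /r_ab (eq_bigl (fun=> true)); last by move=> l; rewrite inE.
rewrite [RHS](eq_bigl (fun=> true)); last by move=> l; rewrite inE.
rewrite (reindex_inj (@perm_inj _ P)) /=; apply: eq_bigr => l _.
by rewrite !ffunE permK.
Qed.

(** The injection sending [Q] to [Q^-1 * P] lands in the stabilizer of [kact P k]. *)
Lemma card_same_act P k : P \in S ->
  (#|[set Q in S | kact Q k == kact P k]| <= Mfact [set: 'I_d]%SET I (kact P k))%N.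
Proof.
rewrite inE => PS; rewrite /Mfact.
rewrite -(card_imset (mem [set Q in S | kact Q k == kact P k])
  (inj_comp (@mulIg _ P) (@invg_inj _))).
apply/subset_leq_card/fintype.subsetP => y /imsetP[Q + ->].
rewrite !inE => /andP[QS /eqP kQ]; apply/andP; split.
  by apply: perm_onM => //; exact: perm_onV.
apply/forallP => j; apply/implyP => _; by rewrite permM ffunE permK -kQ ffunE.
Qed.

Definition weight h : R := (Mfact [set: 'I_d]%SET I h)%:R / #|S|%:R * (r h)^-1.

Lemma weight_ge0 h : 0 <= weight h.
Proof. by rewrite mulr_ge0 ?divr_ge0 // invr_ge0 ltW // r_ab_gt0. Qed.

Definition shift_sum N x : R := \sum_(k <- box N)
  (symcoef n z x I 0 k ^+ 2 + symcoef n z x I (- (pi / 2)) k ^+ 2) / r k.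

Lemma uccube_symcoef psi k : uccube (fun x => symcoef n z x I psi k).
Proof.
apply: uccubeZ; apply: uccube_sum => P.
by apply: uccubeZ; exact: uccube_pwave.
Qed.

Lemma uccube_shift_sum N : uccube (shift_sum N).
Proof.
apply: uccube_sum => k; under [X in uccube X]eq_fun do rewrite mulrC; apply: uccubeZ.
by under [X in uccube X]eq_fun do rewrite !expr2; apply: uccubeD; apply: uccubeM;
  exact: uccube_symcoef.
Qed.

Lemma symcoef_sqr x k :
  symcoef n z x I 0 k ^+ 2 + symcoef n z x I (- (pi / 2)) k ^+ 2 =
  (#|S|%:R^-1) ^+ 2 * \sum_(P in S) \sum_(Q in S)
    ((dualnz n z (kact P k))%:R * (dualnz n z (kact Q k))%:R) * pwave (kact P k - kact Q k) 0 x.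
Proof.
rewrite /symcoef !exprMn -mulrDr; congr (_ * _).
rewrite !expr2 !mulr_suml -big_split /=; apply: eq_bigr => P _.
rewrite !mulr_sumr -big_split /=; apply: eq_bigr => Q _.
rewrite -!pwave_cos -!pwave_sin kdotB mulrBr cosB; ring.
Qed.

(** By orthogonality only the pairs [P], [Q] with [kact P k = kact Q k] survive integration. Their
    number is where the stabilizer, and with it the gain from permutation invariance, enters. *)
Lemma cube_int_symcoef_sqr k :
  cube_int (fun x => symcoef n z x I 0 k ^+ 2 + symcoef n z x I (- (pi / 2)) k ^+ 2) <=
  (#|S|%:R^-1) ^+ 2 * \sum_(P in S) (dualnz n z (kact P k))%:R *
     (Mfact [set: 'I_d]%SET I (kact P k))%:R.
Proof.
have uZ c l : uccube (fun x => c * pwave l 0 x) by apply: uccubeZ; exact: uccube_pwave.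
under eq_fun do rewrite symcoef_sqr.
rewrite /cube_int iter_intZ; [|by do 2 (apply: uccube_sum => ?)|exact: cube0].
rewrite ler_wpM2l ?sqr_ge0 // iter_int_sum; [|by move=> ?; apply: uccube_sum|exact: cube0].
apply: ler_sum => P PS; rewrite iter_int_sum //; last exact: cube0.
rewrite (eq_bigr (fun Q => (dualnz n z (kact P k))%:R * (kact Q k == kact P k)%:R)); last first.
  move=> Q _; rewrite iter_intZ; [|exact: uccube_pwave|exact: cube0].
  rewrite -/(cube_int _) cube_int_pwave subr_eq0 cos0 [kact Q k == _]eq_sym.
  case: eqP => [<-|_]; last by rewrite !mulr0.
  by rewrite !mulr1; case: dualnz; rewrite ?mulr1 ?mulr0.
rewrite -mulr_sumr ler_wpM2l // -natr_sum ler_nat.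
apply: leq_trans (card_same_act k PS).
rewrite -sum1_card big_mkcond /= [X in (_ <= X)%N]big_mkcond /=.
by apply: leq_sum => Q _; rewrite !inE; case: ifP; case: eqP.
Qed.

(** As [r] is invariant under permutations, the mean of the k-th term is at most the average over
    [P] of the dual weights of [kact P k]. For a fixed [P] the map [kact P] is injective, so summing
    over the box gives a finite part of the sum bounded by [M]. *)
Lemma cube_int_shift_sum (M : R) N :
  (\esum_(h in [set h | dualnz n z h]) (weight h)%:E <= M%:E)%E ->
  cube_int (shift_sum N) <= M.
Proof.
move=> HM; set s : R := #|S|%:R; have s0 : 0 < s by rewrite ltr0n Sset_gt0.
have uk k : uccube (fun x => symcoef n z x I 0 k ^+ 2 + symcoef n z x I (- (pi / 2)) k ^+ 2).
  by under [X in uccube X]eq_fun do rewrite !expr2; apply: uccubeD; apply: uccubeM;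
    exact: uccube_symcoef.
have E k : cube_int (fun x => (symcoef n z x I 0 k ^+ 2 +
    symcoef n z x I (- (pi / 2)) k ^+ 2) / r k) <=
    s^-1 * \sum_(P in S) (dualnz n z (kact P k))%:R * weight (kact P k).
  under eq_fun do rewrite mulrC.
  rewrite /cube_int iter_intZ //; last exact: cube0.
  rewrite mulrC ler_pdivrMr ?r_ab_gt0 //.
  apply: le_trans (cube_int_symcoef_sqr k) _.
  rewrite -/s le_eqVlt; apply/orP; left; apply/eqP.
  rewrite expr2 -mulrA -[RHS]mulrA; congr (_ * _); rewrite mulr_suml mulr_sumr.
  apply: eq_bigr => P _; rewrite /weight r_kact -/s.
  by field; rewrite !gt_eqF // r_ab_gt0.
have uk' k : uccube (fun x => (symcoef n z x I 0 k ^+ 2 +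
    symcoef n z x I (- (pi / 2)) k ^+ 2) / r k).
  by under [X in uccube X]eq_fun do rewrite mulrC; exact: uccubeZ.
rewrite /shift_sum /cube_int iter_int_sum //; last exact: cube0.
apply: le_trans (ler_sum _ (fun k _ => E k)) _.
rewrite -mulr_sumr exchange_big /= mulrC ler_pdivrMr //.
rewrite /s mulr_natr -sumr_const; apply: ler_sum => P _.
rewrite (eq_bigr (fun k => if dualnz n z (kact P k) then weight (kact P k) else 0)); last first.
  by move=> k _; case: dualnz; rewrite ?mul1r ?mul0r.
rewrite -(big_map (kact P) predT (fun h => if dualnz n z h then weight h else 0)).
rewrite -big_mkcond /= -big_filter -lee_fin -sumEFin; apply: le_trans HM.
apply: esum_ge_seq.
  by rewrite filter_uniq // (map_inj_uniq (@kact_inj P)) box_uniq.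
by move=> h; rewrite mem_filter => /andP[].
Qed.

Lemma shift_sum_mono N N' x : (N <= N')%N -> shift_sum N x <= shift_sum N' x.
Proof.
move=> NN; rewrite -subr_ge0 box_sumB //; apply: sumr_ge0 => k _.
by rewrite divr_ge0 ?addr_ge0 ?sqr_ge0 // ltW // r_ab_gt0.
Qed.

(* Each partial sum has mean at most M, hence values below M + 1/(N+1); since the
   partial sums increase with N, a cluster point works for all of them. *)
Lemma exists_shift (M : R) :
  (\esum_(h in [set h | dualnz n z h]) (weight h)%:E <= M%:E)%E ->
  exists2 Delta : 'rV[R]_d, (forall i, 0 <= Delta ord0 i < 1) &
    forall N, shift_sum N Delta <= M.
Proof.
move=> HM.
have ex N : exists x, cube x /\ shift_sum N x <= M + N.+1%:R^-1.
  apply: contrapT => H.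
  have : M + N.+1%:R^-1 <= cube_int (shift_sum N).
    rewrite -(@iter_int_cst R d d (M + N.+1%:R^-1) 0).
    apply: le_iter_int; [exact: uccube_cst|exact: uccube_shift_sum|exact: cube0|].
    move=> x xc; rewrite leNgt; apply/negP => Hx; apply: H; exists x; split => //.
    exact: ltW.
  move=> /le_trans /(_ (cube_int_shift_sum N HM)).
  by rewrite gerDl leNgt invr_gt0 ltr0n.
pose u N := projT1 (cid (ex N)).
have uc N : cube (u N) by have [] := projT2 (cid (ex N)).
have uM N : shift_sum N (u N) <= M + N.+1%:R^-1 by have [] := projT2 (cid (ex N)).
have ucF : (u @ \oo) cube by exists 0%N => // m _; exact: uc.
have [p [pc pcl]] := @cube_compact R d (u @ \oo) _ ucF.
(* The cluster point of the closed cube may have coordinates equal to 1; by periodicity fractional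
   parts leave every partial sum unchanged. *)
exists (\row_i Defs.frac (p ord0 i)); first by move=> i; rewrite mxE frac_itv.
move=> N.
have -> : shift_sum N (\row_i Defs.frac (p ord0 i)) = shift_sum N p.
  apply: eq_bigr => k _; congr ((_ ^+ 2 + _ ^+ 2) / _); congr (_ * _);
  by apply: eq_bigr => P _; rewrite pwave_frac.
apply/ler_addgt0Pr => e e0.
have [c c0 Hc] := uccube_shift_sum N (divr_gt0 e0 (ltr0n R 2)).
pose N' := maxn N (Num.truncn (2 / e)).+1.
have [_ [[m Nm <-] Bm]] : [set u m | m in [set m | (N' <= m)%N]] `&` ball p c !=set0.
  apply: pcl; last exact: nbhsx_ballx.
  by exists N' => // m /= Nm; exists m.
have : `|shift_sum N p - shift_sum N (u m)| < e / 2.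
  by apply: Hc => // i; have [_ /(_ ord0 i)] := Bm.
have h1 : shift_sum N (u m) <= M + m.+1%:R^-1.
  by apply: le_trans (uM m); apply: shift_sum_mono; apply: leq_trans Nm; exact: leq_maxl.
have h2 : m.+1%:R^-1 <= e / 2 :> R.
  rewrite -[e / 2]invrK lef_pV2 ?posrE ?invr_gt0 ?divr_gt0 // invf_div.
  apply: ltW; apply: lt_le_trans (truncnS_gt _) _; rewrite ler_nat.
  by apply: leq_trans (leqnSn _); apply: leq_trans Nm; exact: leq_maxr.
have h3 := le_trans h1 (lerD (lexx M) h2).
rewrite ltr_norml => /andP[_]; rewrite ltrBlDr => /ltW h4.
apply: le_trans h4 _; apply: le_trans (lerD (lexx _) h3) _; lra.
Qed.

End Shift.

(** * Stabilizers of frequency vectors *)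

Section Stabilizers.
Context {d : nat}.
Local Notation K := {ffun 'I_d -> int}.
Implicit Types (h : K) (u I : {set 'I_d}) (P Q : {perm 'I_d}).
Local Notation T := [set: 'I_d]%SET.

Lemma card_Sset u I : #|Sset u I| = (#|u :&: I|)`!.
Proof. by rewrite -card_perm; apply: eq_card => P; rewrite !inE. Qed.

Lemma Mfact_setT I h :
  Mfact T I h = #|[set P | perm_on I P & [forall j, h (P j) == h j]]%SET|.
Proof.
apply: eq_card => P; rewrite !inE finset.setTI; congr (_ && _).
by apply: eq_forallb => j; rewrite inE.
Qed.

Lemma perm_on_restr P u : (forall j, (P j \in u) = (j \in u)) ->
  exists2 Q, perm_on u Q & forall j, j \in u -> Q j = P j.
Proof.
move=> Pu; pose f j := if j \in u then P j else j.
have fi : injective f.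
  move=> i j; rewrite /f; case: ifPn => iu; case: ifPn => ju //.
  - exact: perm_inj.
  - by move=> E; move: ju; rewrite -E Pu iu.
  - by move=> E; move: iu; rewrite E Pu ju.
exists (perm fi); last by move=> j ju; rewrite permE /f ju.
by apply/fintype.subsetP => j; rewrite inE permE /f; case: ifP => //; rewrite eqxx.
Qed.

(** A permutation fixing [h] preserves its support u. It thus factors uniquely into a stabilizer
    acting inside u and an arbitrary permutation of [I :\: u], where [h] vanishes. *)
Lemma Mfact_supp u I h : (forall j, (j \in u) = (h j != 0)) ->
  Mfact T I h = (Mfact u I h * (#|I :\: u|)`!)%N.
Proof.
move=> hu; rewrite Mfact_setT /Mfact -[(#|I :\: u|)`!]card_perm.
set A := finset _; set B := finset _.
have Bu b j : b \in B -> (b j \in u) = (j \in u).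
  rewrite inE => /andP[]; rewrite inE => bu _; case: (boolP (j \in u :&: I)) => jI.
    have := perm_closed j bu; rewrite jI inE => /andP[-> _].
    by move: jI; rewrite inE => /andP[->].
  by rewrite (out_perm bu).
have Bout b j : b \in B -> j \notin u -> b j = j.
  by rewrite !inE => /andP[bu _] ju; rewrite (out_perm bu) // inE negb_and ju.
have Cin (c : {perm 'I_d}) j : perm_on (I :\: u) c -> j \in u -> c j = j.
  by move=> cI ju; rewrite (out_perm cI) // inE ju.
have Cu (c : {perm 'I_d}) j : perm_on (I :\: u) c -> (c j \in u) = (j \in u).
  move=> cI; case: (boolP (j \in u)) => ju; first by rewrite Cin.
  case: (boolP (j \in I)) => jI.
    have jD : j \in I :\: u by rewrite inE ju.
    by have := perm_closed j cI; rewrite jD inE => /andP[/negbTE ->].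
  by rewrite (out_perm cI) ?(negbTE ju) // inE (negbTE jI) andbF.
rewrite -[#|perm_on _|]cardsE -cardsX.
set X := finset.setX _ _.
rewrite -(@card_in_imset _ _ (fun p => (p.1 * p.2)%g) (mem X)); last first.
  move=> [b c] [b' c'] /setXP[/= bB]; rewrite inE => cC /setXP[/= bB']; rewrite inE => cC' E.
  have bb : b = b'.
    apply/permP => j; case: (boolP (j \in u)) => ju; last by rewrite !Bout.
    move/permP/(_ j): E; rewrite /= !permM.
    by rewrite (Cin c) // ?(Cin c') // ?Bu.
  by move: E; rewrite bb => /mulgI /= ->.
apply: eq_card => P; apply/idP/imsetP => [|[[b c] /setXP[/= bB]]].
  rewrite !inE => /andP[PI /forallP hP].
  have Pu j : (P j \in u) = (j \in u) by rewrite !hu (eqP (hP j)).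
  have [b bu bP] := perm_on_restr Pu.
  have Pout j : j \notin I -> P j = j by move=> jI; rewrite (out_perm PI).
  have bI : perm_on (u :&: I) b.
    apply/fintype.subsetP => j; rewrite !inE => bj.
    have ju : j \in u by apply: contraNT bj => ju; rewrite (out_perm bu).
    by rewrite ju /=; apply: contraNT bj => jI; rewrite bP // Pout.
  exists (b, (b^-1 * P)%g); last by rewrite /= mulKVg.
  apply/setXP; rewrite /= !inE bI /=; split.
    by apply/forall_inP => j ju; rewrite bP.
  apply/fintype.subsetP => j; rewrite !inE permM => /eqP Pj.
  have ju : j \notin u.
    apply/negP => ju; apply: Pj; rewrite -bP ?permKV //.
    by have := perm_closed ((b^-1)%g j) bu; rewrite permKV ju.
  rewrite ju /=; apply/negP => /negP jI; apply: Pj.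
  have -> : (b^-1)%g j = j by apply: (@perm_inj _ b); rewrite permKV (out_perm bu).
  exact: Pout.
rewrite inE => cC ->; rewrite inE; apply/andP; split.
  have bI : perm_on I b.
    move: bB; rewrite !inE => /andP[bu _].
    by apply: fintype.subset_trans bu _; exact: finset.subsetIr.
  apply: perm_onM => //; apply: fintype.subset_trans cC _; exact: finset.subsetDl.
apply/forallP => j; rewrite /= permM; case: (boolP (j \in u)) => ju.
  rewrite (Cin c) ?Bu //; move: bB; rewrite !inE => /andP[_ /forall_inP]; exact.
rewrite (Bout b) //; have := Cu c j cC; rewrite (negbTE ju) => /negbT.
by rewrite hu negbK => /eqP ->; move: ju; rewrite hu negbK eq_sym.
Qed.

(** A stabilizer of [h] that fixes [l] also stabilizes [h'], and for [l] outside [I] all of them do.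
    Otherwise the stabilizers are grouped by the image of [l] in [I]; right multiplication by the
    inverse of one member carries a group into those that fix [l]. *)
Lemma Mfact_change I h h' (l : 'I_d) : (forall j, j != l -> h j = h' j) ->
  (Mfact T I h <= maxn 1 #|I| * Mfact T I h')%N.
Proof.
move=> hh'; rewrite !Mfact_setT; set A := finset _; set A' := finset _.
have fixl P : P \in A -> P l = l -> P \in A'.
  rewrite !inE => /andP[-> /forallP hP] Pl; apply/forallP => j /=.
  case: (eqVneq j l) => [->|jl]; first by rewrite Pl.
  by rewrite -!hh' //; apply: contra_neq jl => E; apply: (@perm_inj _ P); rewrite Pl.
case: (boolP (l \in I)) => lI; last first.
  apply: leq_trans (_ : #|A'| <= _)%N; last by rewrite leq_pmull // leq_max.
  apply/subset_leq_card/fintype.subsetP => P PA; apply: fixl => //.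
  by move: PA; rewrite inE => /andP[PI _]; rewrite (out_perm PI).
apply: leq_trans (_ : #|I| * #|A'| <= _)%N; last by rewrite leq_mul2r leq_maxr orbT.
have -> : #|A| = (\sum_(i in I) #|[set P in A | P l == i]%SET|)%N.
  rewrite -sum1_card (partition_big (fun P => P l) (mem I)) /=.
    by apply: eq_bigr => i _; rewrite -sum1_card; apply: eq_bigl => P; rewrite !inE.
  by move=> P; rewrite inE => /andP[PI _]; rewrite (perm_closed l PI).
rewrite -sum_nat_const; apply: leq_sum => i _.
case: (set_0Vmem [set P in A | P l == i]%SET%SET) => [->|[P0]]; first by rewrite cards0.
rewrite inE => /andP[P0A /eqP P0l].
rewrite -(card_imset (mem [set P in A | P l == i]%SET) (@mulIg _ (P0^-1)%g)).
apply/subset_leq_card/fintype.subsetP => Q' /imsetP[P + ->].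
rewrite inE => /andP[PA /eqP Pl]; apply: fixl; last first.
  by rewrite permM Pl -P0l permK.
move: PA P0A; rewrite !inE => /andP[PI /forallP hP] /andP[P0I /forallP hP0].
rewrite perm_onM ?perm_onV //=; apply/forallP => j; rewrite permM -(eqP (hP j)).
by have := hP0 ((P0^-1)%g (P j)); rewrite permKV eq_sym.
Qed.

End Stabilizers.

(** * The component-by-component construction *)

Section EsumTools.
Context {R : realType}.
Local Open Scope ereal_scope.

Lemma esum_le_seq (T : choiceType) (S : set T) (a : T -> \bar R) (M : \bar R) :
  (forall s : seq T, uniq s -> (forall x, x \in s -> S x) -> \sum_(x <- s) a x <= M) ->
  \esum_(x in S) a x <= M.
Proof.
move=> H; apply: ge_ereal_sup => _ [X [fX XS] <-].
rewrite fsbig_finite //; apply: H; first exact: finmap.fset_uniq.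
by move=> x; rewrite in_fset_set // inE; exact: XS.
Qed.

Lemma esumZl (T : choiceType) (S : set T) (a : T -> \bar R) (c : R) : (0 <= c)%R ->
  (forall x, S x -> 0 <= a x) -> \esum_(x in S) (c%:E * a x) = c%:E * \esum_(x in S) a x.
Proof.
have le (b : T -> \bar R) (e : R) : (0 <= e)%R -> (forall x, S x -> 0 <= b x) ->
    \esum_(x in S) (e%:E * b x) <= e%:E * \esum_(x in S) b x.
  move=> e0 b0; apply: esum_le_seq => s us sS.
  have -> : \sum_(x <- s) e%:E * b x = e%:E * \sum_(x <- s) b x.
    by rewrite big_seq [in RHS]big_seq ge0_sume_distrr // => x /sS; exact: b0.
  by rewrite lee_wpmul2l // ?lee_fin // esum_ge_seq.
move=> c0 a0; have [->|cn0] := eqVneq c 0%R.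
  by rewrite mul0e esum1 // => x _; rewrite mul0e.
apply/eqP; rewrite eq_le le //=.
have c0E : 0 <= c%:E by rewrite lee_fin.
have cV0 : (0 <= c^-1)%R by rewrite invr_ge0.
have := le (fun x => c%:E * a x) (c^-1)%R cV0 (fun x Sx => mule_ge0 c0E (a0 x Sx)).
rewrite (eq_esum (b := a)); last by move=> x _; rewrite muleA -EFinM mulVf // mul1e.
move=> /(lee_wpmul2l c0E).
by rewrite muleA -EFinM mulfV // mul1e.
Qed.

Lemma esum_le_inj (T T' : choiceType) (A : set T) (B : set T') (f : T -> T')
    (a : T -> \bar R) (b : T' -> \bar R) :
  {in A &, injective f} -> (forall x, A x -> B (f x)) -> (forall x, A x -> a x <= b (f x)) ->
  \esum_(x in A) a x <= \esum_(y in B) b y.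
Proof.
move=> fi fB ab; apply: esum_le_seq => s us sA.
apply: le_trans (_ : \sum_(x <- s) b (f x) <= _).
  by rewrite big_seq [leRHS]big_seq; apply: lee_sum => x /sA; exact: ab.
rewrite -(big_map f predT b); apply: esum_ge_seq.
  by rewrite map_inj_in_uniq // => x y /sA xA /sA yA; apply: fi; rewrite inE.
by move=> _ /mapP[x /sA xA ->]; exact: fB.
Qed.

Lemma esum_mkcond_andb (T : choiceType) (A B : pred T) (a : T -> \bar R) :
  \esum_(x in [set x | A x && B x]) a x = \esum_(x in [set x | A x]) (if B x then a x else 0).
Proof.
have -> : [set x | A x && B x] = [set x | A x] `&` [set x | B x].
  by apply/seteqP; split => x /= => [/andP[]|[-> ->]].
rewrite esum_mkcondr; apply: eq_esum => x _.
by case: ifPn => [/set_mem /= ->|]; [|rewrite notin_setE /= => /negP /negbTE ->].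
Qed.

(** For x in (0, 1] one has x <= x^p; apply this to the fractions a / (a + b) and b / (a + b), which
    add up to 1. *)
Lemma powR_add_le (a b p : R) : (0 < p <= 1)%R -> (0 <= a)%R -> (0 <= b)%R ->
  ((a + b) `^ p <= a `^ p + b `^ p)%R.
Proof.
move=> /andP[p0 p1] a_ge0 b_ge0; have [->|an0] := eqVneq a 0%R.
  by rewrite add0r powR0 ?add0r // gt_eqF.
have [->|bn0] := eqVneq b 0%R; first by rewrite addr0 powR0 ?addr0 // gt_eqF.
have a0 : (0 < a)%R by rewrite lt_def an0.
have b0 : (0 < b)%R by rewrite lt_def bn0.
have ab0 : (0 < a + b)%R by rewrite addr_gt0.
have E (c : R) : (0 < c)%R -> (c <= a + b)%R -> ((a + b) `^ p * (c / (a + b)) <= c `^ p)%R.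
  move=> c0 cab; have -> : (c `^ p = (a + b) `^ p * (c / (a + b)) `^ p)%R.
    rewrite -powRM ?divr_ge0 ?(ltW c0) ?(ltW ab0) //; congr (_ `^ p)%R.
    by field; rewrite gt_eqF.
  rewrite ler_wpM2l ?powR_ge0 // ger1_powR // divr_gt0 //=.
  by rewrite ler_pdivrMr // mul1r.
have h1 : ((a + b) `^ p * (a / (a + b)) <= a `^ p)%R by apply: E; rewrite ?lerDl.
have h2 : ((a + b) `^ p * (b / (a + b)) <= b `^ p)%R by apply: E; rewrite ?lerDr.
have -> : ((a + b) `^ p = (a + b) `^ p * (a / (a + b)) + (a + b) `^ p * (b / (a + b)))%R.
  by rewrite -mulrDr -mulrDl divff ?mulr1 // gt_eqF.
exact: lerD.
Qed.

Lemma sum_le_powR (T : Type) (s : seq T) (a : T -> R) (p : R) :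
  (0 < p <= 1)%R -> (forall x, 0 <= a x)%R ->
  ((\sum_(x <- s) a x) `^ p <= \sum_(x <- s) (a x) `^ p)%R.
Proof.
move=> p01 a0; elim: s => [|x s IH].
  by rewrite !big_nil powR0 // gt_eqF //; case/andP: p01.
rewrite !big_cons; apply: le_trans (powR_add_le p01 (a0 x) _) _; last by rewrite lerD2l.
exact: sumr_ge0.
Qed.

Lemma esum_le_poweR (T : choiceType) (S : set T) (a : T -> R) (lam : R) :
  (1 <= lam)%R -> (forall x, 0 <= a x)%R ->
  \esum_(x in S) (a x)%:E <= (\esum_(x in S) (a x `^ lam^-1)%:E) `^ lam.
Proof.
move=> l1 a0; have l0 : (0 < lam)%R by apply: lt_le_trans l1.
apply: esum_le_seq => s us sS.
have -> : \sum_(x <- s) (a x)%:E = ((\sum_(x <- s) a x) `^ lam^-1)%:E `^ lam.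
  rewrite sumEFin poweR_EFin -powRrM mulVf ?gt_eqF // powRr1 //.
  exact: sumr_ge0.
have W0 : 0 <= \esum_(x in S) (a x `^ lam^-1)%:E.
  by apply: esum_ge0 => x _; rewrite lee_fin powR_ge0.
apply: gt0_ler_poweR; first exact: ltW.
- by rewrite in_itv /= lee_fin powR_ge0 leey.
- by rewrite in_itv /= W0 leey.
apply: le_trans (_ : \sum_(x <- s) (a x `^ lam^-1)%:E <= _); last exact: esum_ge_seq.
rewrite sumEFin lee_fin; apply: sum_le_powR => //.
by rewrite invr_gt0 l0 /= invf_le1.
Qed.

(** Subadditivity of the power 1 / lam, applied to the terms [x t] raised to lam. *)
Lemma sum_powR_le (T : Type) (s : seq T) (x : T -> R) (lam : R) :
  (1 <= lam)%R -> (forall t, 0 <= x t)%R ->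
  (\sum_(t <- s) x t `^ lam <= (\sum_(t <- s) x t) `^ lam)%R.
Proof.
move=> l1 x0; have l0 : (0 < lam)%R by apply: lt_le_trans l1.
have lV : (0 < lam^-1 <= 1)%R by rewrite invr_gt0 l0 /= invf_le1.
have := sum_le_powR s lV (fun t => powR_ge0 (x t) lam).
under [leRHS]eq_bigr do rewrite -powRrM mulfV ?gt_eqF // powRr1 //.
move=> h; have S0 : (0 <= \sum_(t <- s) x t `^ lam)%R by apply: sumr_ge0 => t _; exact: powR_ge0.
rewrite -[leLHS](powRr1 S0) -(mulVf (lt0r_neq0 l0)) powRrM.
by apply: ge0_ler_powR => //; rewrite ?nnegrE ?powR_ge0 ?sumr_ge0 // ltW.
Qed.

End EsumTools.

(** * Frequencies sorted by their last nonzero entry *)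

Section LastNonzero.
Context {d : nat}.
Local Notation K := {ffun 'I_d -> int}.
Implicit Types (h : K) (l : 'I_d).

Definition last_nonzero l h : bool :=
  (h l != 0) && [forall j : 'I_d, (l < j)%N ==> (h j == 0)].

Lemma last_nonzero_uniq l l' h : last_nonzero l h -> last_nonzero l' h -> l = l'.
Proof.
move=> /andP[hl /forallP Hl] /andP[hl' /forallP Hl']; apply: ord_inj; apply/eqP.
rewrite eqn_leq; apply/andP; split; rewrite leqNgt; apply/negP => ll.
  by have := Hl' l; rewrite ll (negbTE hl).
by have := Hl l'; rewrite ll (negbTE hl').
Qed.

Lemma exists_last_nonzero h : h != 0 -> exists l, last_nonzero l h.
Proof.
move=> h0; have [j hj] : exists j, h j != 0.
  apply/existsP; apply: contraNT h0; rewrite negb_exists => /forallP H.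
  by apply/eqP/ffunP => j; rewrite ffunE; apply/eqP; have := H j; rewrite negbK.
case: (arg_maxnP (fun j : 'I_d => val j) (hj : (fun j => h j != 0) j)) => l hl Hl.
exists l; rewrite /last_nonzero hl; apply/forallP => i; apply/implyP => li.
by apply: contraLR li => hi; rewrite -leqNgt; exact: Hl.
Qed.

Lemma esum_last_nonzero (R : realType) (f : K -> \bar R) : (forall h, 0 <= f h)%E ->
  (\esum_(h in [set h : K | h != 0%R]) f h =
   \sum_(l : 'I_d) \esum_(h in [set h | last_nonzero l h]) f h)%E.
Proof.
move=> f0; rewrite esum_mkcond.
under [RHS]eq_bigr do rewrite esum_mkcond.
rewrite -esum_sum; last by move=> h l _ _; case: ifP.
apply: eq_esum => h _; case: (eqVneq h 0) => [->|h0].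
  rewrite memNset /= ?eqxx // big1 // => l _.
  by rewrite memNset //= /last_nonzero ffunE eqxx.
rewrite mem_set //; have [l hl] := exists_last_nonzero h0.
rewrite (bigD1 l) //= mem_set //= big1 ?adde0 // => l' ll'.
by rewrite memNset //= => hl'; rewrite (last_nonzero_uniq hl hl') eqxx in ll'.
Qed.

End LastNonzero.

Section Criterion.
Context {R : realType} {d : nat}.
Variables (Rf : R -> R) (alpha beta0 beta1 : R).
Hypotheses (HRpos : forall x : R, 1 <= x -> 0 < Rf x) (Hb0 : 0 < beta0) (Hb1 : 0 < beta1).
Variables (n : nat) (I : {set 'I_d}).
Local Notation K := {ffun 'I_d -> int}.
Implicit Types (h : K) (u : {set 'I_d}) (l : 'I_d) (z : 'I_d -> nat).
Local Notation T := [set: 'I_d]%SET.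
Local Notation w := (@weight R d Rf alpha beta0 beta1 I).

Lemma in_dual_supp z u h : (forall j, (j \in u) = (h j != 0)) -> in_dual n z u h = in_dual n z T h.
Proof.
move=> hu; rewrite /in_dual; congr (_ %| _)%Z; rewrite big_mkcond [RHS]big_mkcond /=.
by apply: eq_bigr => j _; rewrite inE hu; case: eqP => [->|]; rewrite ?mul0r.
Qed.

(** This explains the normalisation [c_uI]. The coordinates off u contribute [beta0 ^+ (d - #|u|)]
    to 1 / r, the stabilizer grows by the factorial of [#|I :\: u|], and #S grows from the factorial
    of [#|I :&: u|] to that of [#|I|]; the factorials combine to the inverse binomial
    coefficient. *)
Lemma weight_supp u h : (forall j, (j \in u) = (h j != 0)) ->
  beta0 ^+ d * ((c_uI beta0 u I)^-1 * ((Mfact u I h)%:R / #|Sset u I|%:R *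
    (r_ab Rf alpha beta0 beta1 u h)^-1)) = w h.
Proof.
move=> hu; rewrite /weight (Mfact_supp I hu) !card_Sset finset.setTI.
rewrite !r_ab_inv.
have -> : \prod_(l in T) coord_weight Rf alpha beta0 beta1 (h l) =
    beta0 ^+ (d - #|u|) * \prod_(l in u) coord_weight Rf alpha beta0 beta1 (h l).
  rewrite (bigID (fun l => l \in u)) /= mulrC; congr (_ * _).
    rewrite (eq_bigr (fun=> beta0)); last first.
      by move=> l; rewrite inE /= hu negbK /coord_weight => ->.
    rewrite prodr_const -[d in (d - _)%N]card_ord -(cardC (mem u)); congr (_ ^+ _).
    by rewrite addKn; apply: eq_card => j; rewrite [RHS]inE unfold_in inE.
  by apply: eq_bigl => j; rewrite inE.
rewrite /c_uI [u :&: I]finset.setIC.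
have ud : (#|u| <= d)%N by rewrite -[d in (_ <= d)%N]card_ord max_card.
have kI : (#|I :&: u| <= #|I|)%N by apply/subset_leq_card/finset.subsetIl.
have cD : #|I :\: u| = (#|I| - #|I :&: u|)%N by rewrite cardsD.
rewrite -(bin_fact kI) -cD !natrM -[in beta0 ^+ d](subnKC ud) exprD.
set B := \prod_(_ in _) _.
have fact0 m : ((m`!)%:R : R) != 0 by rewrite pnatr_eq0 -lt0n fact_gt0.
have bin0 : (('C(#|I|, #|I :&: u|))%:R : R) != 0 by rewrite pnatr_eq0 -lt0n bin_gt0.
field; rewrite !fact0 bin0 /= expf_neq0 //.
by rewrite gt_eqF.
Qed.

(** Each [h] occurs in the criterion for only one set, its support, and the condition on that set
    says that [l] is its largest element. *)
Lemma B_critE z l : ((beta0 ^+ d)%:E * B_crit Rf alpha beta0 beta1 I n z l =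
  \esum_(h in [set h | last_nonzero l h && in_dual n z T h]) (w h)%:E)%E.
Proof.
have w0 h : 0 <= w h by exact: weight_ge0.
have b0 : 0 < beta0 ^+ d by rewrite exprn_gt0.
have c0 u : 0 <= (c_uI beta0 u I)^-1 by rewrite invr_ge0 mulr_ge0 // exprn_ge0 // ltW.
have X0 u h : 0 <= (Mfact u I h)%:R / (#|Sset u I|)%:R
   * (r_ab Rf alpha beta0 beta1 u h)^-1 * (if in_dual n z u h then 1 else 0).
  by rewrite !mulr_ge0 // ?invr_ge0 // ?(ltW (r_ab_gt0 _ _ _ _ _ _)) //; case: ifP.
rewrite /B_crit ge0_sume_distrr; last first.
  move=> u _; apply: mule_ge0; first by rewrite lee_fin.
  by apply: esum_ge0 => h _; rewrite lee_fin.
pose supp h : {set 'I_d} := [set j | h j != 0]%SET.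
have suppP u h : nonzero_on u h <-> u = supp h.
  split=> [H|-> j]; last by rewrite inE.
  by apply/finset.setP => j; rewrite inE H.
rewrite (eq_bigr (fun u => \esum_(h in [set: K])
    (if u == supp h then (w h * (if in_dual n z T h then 1 else 0))%:E else 0)%E)); last first.
  move=> u _; rewrite muleA -EFinM -esumZl; last 2 first.
  - by rewrite mulr_ge0 // ltW.
  - by move=> h _; rewrite lee_fin.
  rewrite esum_mkcond; apply: eq_esum => h _.
  case: (eqVneq u (supp h)) => [uh|uh]; last first.
    by rewrite memNset // => /suppP /eqP; rewrite (negbTE uh).
  have hu : nonzero_on u h by apply/suppP.
  rewrite mem_set // -EFinM; congr EFin.
  by rewrite -(weight_supp hu) (in_dual_supp z hu); set D := (if _ then _ else _); ring.
rewrite -esum_sum; last by move=> h u _ _; case: ifP => // _; rewrite lee_fin mulr_ge0 //; case: ifP.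
rewrite [RHS]esum_mkcond; apply: eq_esum => h _.
rewrite -big_mkcondr /=.
have lnE : last_nonzero l h = (supp h \subset [set j : 'I_d | (val j <= val l)%N]) && (l \in supp h).
  rewrite /last_nonzero andbC [l \in _]inE; congr (_ && _).
  apply/forallP/fintype.subsetP => [H j|H j].
    rewrite [j \in supp h]inE => hj; apply/mem_set; rewrite /= leqNgt; apply/negP => lj.
    by have := H j; rewrite lj (negbTE hj).
  apply/implyP => lj; apply: contraLR lj => hj; rewrite -leqNgt.
  by have := H j; rewrite [j \in supp h]inE => /(_ hj) /set_mem.
have [hl|hl] := boolP (last_nonzero l h).
  rewrite (big_pred1 (supp h)); last first.
    move=> u /=; case: (eqVneq u (supp h)) => [->|]; last by rewrite andbF.
    by rewrite -lnE hl.
  case: (boolP (in_dual n z T h)) => hd; rewrite ?mulr1 ?mulr0.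
    by rewrite mem_set //= hl hd.
  by rewrite memNset //= (negbTE hd) andbF.
rewrite big_pred0; first by rewrite memNset //= (negbTE hl).
move=> u /=; case: (eqVneq u (supp h)) => [->|]; last by rewrite andbF.
by rewrite -lnE (negbTE hl).
Qed.

End Criterion.

Lemma dvdn_dist_eq (n a b : nat) : (a < n)%N -> (b < n)%N ->
  (n %| `|(a%:Z - b%:Z)%R|)%N -> a = b.
Proof.
move=> an bn nd; case: (posnP `|(a%:Z - b%:Z)%R|) => [|ab]; first by lia.
by have := dvdn_leq ab nd; lia.
Qed.

Section ComponentByComponent.
Context {R : realType} {d : nat}.
Variables (Rf : R -> R) (cR alpha beta0 beta1 : R).
Hypotheses (HRpos : forall x : R, 1 <= x -> 0 < Rf x) (HcR : 1 <= cR)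
  (HRmul : forall n m : nat, (0 < n)%N -> (0 < m)%N ->
     cR^-1 * Rf m%:R <= Rf (n * m)%:R / n%:R <= Rf m%:R)
  (Halpha : 0 <= alpha) (Hb0 : 0 < beta0) (Hb1 : 0 < beta1).
Variables (I : {set 'I_d}) (n : nat).
Hypotheses (Hn : prime n) (HncR : cR <= n%:R).
Local Notation K := {ffun 'I_d -> int}.
Implicit Types (h : K) (l : 'I_d) (z : 'I_d -> nat).
Local Notation T := [set: 'I_d]%SET.
Local Notation w := (@weight R d Rf alpha beta0 beta1 I).
Local Notation cw := (coord_weight Rf alpha beta0 beta1).
Local Notation m := ((maxn 1 #|I|)%:R : R).

Let n0 : (0 < n)%N := prime_gt0 Hn.
Let nR : 0 < (n%:R : R). Proof. by rewrite ltr0n. Qed.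
Let cR0 : 0 < cR. Proof. exact: lt_le_trans HcR. Qed.
Let w0 h : 0 <= w h. Proof. exact: weight_ge0. Qed.

(** The lower growth bound Rf (n |q|) >= (n / cR) Rf |q|, raised to the nonpositive power - 2
    alpha. *)
Lemma coord_weight_dilate (q : int) : q != 0 ->
  cw (q * n%:Z) <= (cR / n%:R) `^ (2 * alpha) * cw q.
Proof.
move=> q0; have qn0 : q * n%:Z != 0 by rewrite mulf_neq0 // eqz_nat -lt0n.
have q1 : (0 < `|q|)%N by rewrite absz_gt0.
rewrite /coord_weight (negbTE q0) (negbTE qn0) mulrCA ler_pM2l // abszM /= mulnC.
have Rq : 0 < Rf `|q|%N%:R by rewrite HRpos // ler1n.
have /andP[h _] := HRmul n0 q1.
have lb : (cR / n%:R)^-1 * Rf `|q|%N%:R <= Rf (n * `|q|)%:R.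
  move: h; rewrite ler_pdivlMr // invf_div => h.
  by apply: le_trans h; rewrite le_eqVlt; apply/orP; left; apply/eqP; ring.
have cn0 : 0 < cR / n%:R by rewrite divr_gt0.
have ln0 : 0 < (cR / n%:R)^-1 * Rf `|q|%N%:R by rewrite mulr_gt0 ?invr_gt0.
have yE : Rf `|q|%N%:R `^ (2 * alpha) =
    (cR / n%:R) `^ (2 * alpha) * ((cR / n%:R)^-1 * Rf `|q|%N%:R) `^ (2 * alpha).
  by rewrite -powRM ?(ltW cn0) ?(ltW ln0) // mulrA mulfV ?mul1r // gt_eqF.
rewrite !powRN yE invfM mulrA mulfV ?mul1r ?gt_eqF ?powR_gt0 //.
rewrite lef_pV2 ?posrE ?powR_gt0 //; last exact: lt_le_trans lb.
have a0 : 0 <= 2 * alpha by rewrite mulr_ge0.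
by apply: ge0_ler_powR; rewrite ?nnegrE ?(ltW ln0) // (le_trans (ltW ln0)).
Qed.

Definition quot l h : K := [ffun j => if j == l then (h l %/ n%:Z)%Z else h j].

Lemma quot_mul l h : (n%:Z %| h l)%Z -> h l = quot l h l * n%:Z.
Proof. by move=> nh; rewrite ffunE eqxx divzK. Qed.

Lemma quot_neq l h j : j != l -> quot l h j = h j.
Proof. by move=> /negbTE jl; rewrite ffunE jl. Qed.

Lemma last_nonzero_quot l h : last_nonzero l h -> (n%:Z %| h l)%Z -> last_nonzero l (quot l h).
Proof.
move=> /andP[hl /forallP H] nh; apply/andP; split.
  by apply: contra_neq hl => q0; rewrite (quot_mul nh) q0 mul0r.
apply/forallP => j; apply/implyP => lj; rewrite quot_neq; first by have := H j; rewrite lj.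
by rewrite -val_eqE gtn_eqF.
Qed.

Lemma weight_quot l h : last_nonzero l h -> (n%:Z %| h l)%Z ->
  w h <= m * (cR / n%:R) `^ (2 * alpha) * w (quot l h).
Proof.
move=> lh nh; have /andP[q0 _] := last_nonzero_quot lh nh.
rewrite /weight !r_ab_inv (bigD1 l) ?inE //= [in leRHS](bigD1 l) ?inE //=.
rewrite (eq_bigr (fun j => cw (quot l h j))); last first.
  by move=> j /andP[_ jl]; rewrite quot_neq.
set B := \prod_(_ in T | _) _; set s : R := #|Sset T I|%:R.
have B0 : 0 <= B by apply: prodr_ge0 => j _; rewrite ltW // coord_weight_gt0.
have s0 : 0 < s by rewrite ltr0n Sset_gt0.
have hM : (Mfact T I h)%:R <= m * (Mfact T I (quot l h))%:R :> R.
  by rewrite -natrM ler_nat; apply: (@Mfact_change _ _ _ _ l) => j jl; rewrite quot_neq.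
have hc : cw (h l) <= (cR / n%:R) `^ (2 * alpha) * cw (quot l h l).
  by rewrite {1}(quot_mul nh) coord_weight_dilate.
have -> : m * (cR / n%:R) `^ (2 * alpha) * ((Mfact T I (quot l h))%:R / s * (cw (quot l h l) * B)) =
   (m * (Mfact T I (quot l h))%:R / s) * ((cR / n%:R) `^ (2 * alpha) * cw (quot l h l) * B) by ring.
apply: ler_pM; rewrite ?divr_ge0 ?mulr_ge0 // ?(ltW s0) //.
- by rewrite ltW // coord_weight_gt0.
- by rewrite ler_wpM2r // invr_ge0 ltW.
- by rewrite ler_wpM2r.
Qed.

Section Exponent.
Variable lam : R.
Hypothesis Hlam : 1 <= lam < 2 * alpha.

Let lam0 : 0 < lam. Proof. by case/andP: Hlam => l1 _; apply: lt_le_trans l1. Qed.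
Let p := lam^-1.
Let p0 : 0 < p. Proof. by rewrite invr_gt0. Qed.

Local Notation W l := (\esum_(h in [set h | last_nonzero l h]) (w h `^ p)%:E)%E.

Lemma maxcard_ge1 : 1 <= m.
Proof. by rewrite ler1n leq_max. Qed.

Lemma maxcard_powR_ge1 : 1 <= m `^ p.
Proof. by rewrite -[leLHS](powRr0 m); apply: ler_powR; [exact: maxcard_ge1 | exact: ltW]. Qed.

Lemma W_ge0 l : (0 <= W l)%E.
Proof. by apply: esum_ge0 => h _; rewrite lee_fin powR_ge0. Qed.

(* Dividing the last nonzero entry by n changes the stabilizer, whence the factor
   max(1, #I); it also gains (cR / n)^(2 alpha / lam) <= cR / n. *)
Lemma esum_multiples l :
  (\esum_(h in [set h | last_nonzero l h && (n%:Z %| h l)%Z]) (w h `^ p)%:E <=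
   (cR * m `^ p / n%:R)%:E * W l)%E.
Proof.
have c0 : 0 <= cR * m `^ p / n%:R by rewrite divr_ge0 ?mulr_ge0 ?powR_ge0 // ltW.
rewrite -esumZl //; last by move=> h _; rewrite lee_fin powR_ge0.
apply: (@esum_le_inj _ _ _ _ _ (quot l)).
- move=> h h' /set_mem /= /andP[_ nh] /set_mem /= /andP[_ nh'] E; apply/ffunP => j.
  case: (eqVneq j l) => [->|jl]; first by rewrite (quot_mul nh) (quot_mul nh') E.
  by rewrite -(quot_neq h jl) -(quot_neq h' jl) E.
- by move=> h /= /andP[lh nh]; exact: last_nonzero_quot.
move=> h /= /andP[lh nh]; rewrite -EFinM lee_fin.
have cn0 : 0 < cR / n%:R by rewrite divr_gt0.
have cn1 : cR / n%:R <= 1 by rewrite ler_pdivrMr // mul1r.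
apply: le_trans (_ : (m * (cR / n%:R) `^ (2 * alpha) * w (quot l h)) `^ p <= _).
  apply: (ge0_ler_powR (ltW p0)); [exact: w0| |exact: weight_quot].
  by rewrite nnegrE; apply: mulr_ge0; [apply: mulr_ge0; [|exact: powR_ge0]|].
rewrite powRM; [|by apply: mulr_ge0; [|exact: powR_ge0]|exact: w0].
rewrite powRM; [|by []|exact: powR_ge0].
rewrite -powRrM ler_wpM2r ?powR_ge0 //.
have -> : cR * m `^ p / n%:R = m `^ p * (cR / n%:R) by ring.
(* The base is at most 1 because cR <= n, and the exponent 2 alpha / lam is at least 1 because lam <
   2 alpha. *)
rewrite ler_wpM2l ?powR_ge0 //; apply: ge1r_powR; first by rewrite cn0.
by rewrite /p ler_pdivlMr // mul1r; case/andP: Hlam => _ /ltW.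
Qed.

Definition setz z l (t : nat) : 'I_d -> nat := fun j => if j == l then t else z j.

Lemma in_dual_setz z l t h : in_dual n (setz z l t) T h =
  (n%:Z %| \sum_(j | j != l) h j * (z j)%:Z + h l * t%:Z)%Z.
Proof.
rewrite /in_dual (bigD1 l) ?inE //= /setz eqxx addrC; congr (_ %| _ + _)%Z.
apply: eq_big => j; first by rewrite inE.
by move=> /andP[_ /negbTE ->].
Qed.

Lemma card_dual_setz z l h :
  (\sum_(t < n) in_dual n (setz z l t) T h <= 1 + n * (n%:Z %| h l)%Z)%N.
Proof.
case: (boolP (n%:Z %| h l)%Z) => nh.
  rewrite muln1; apply: leq_trans (leq_addl _ _).
  apply: leq_trans (_ : \sum_(t < n) 1 <= _)%N; first by apply: leq_sum => t _; case: in_dual.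
  by rewrite sum_nat_const card_ord muln1.
rewrite muln0 addn0 -big_mkcond /= sum1_card; apply/card_le1_eqP => t t' ht ht'.
have d1 : in_dual n (setz z l t) T h by exact: ht.
have d2 : in_dual n (setz z l t') T h by exact: ht'.
rewrite in_dual_setz in d1; rewrite in_dual_setz in d2; apply: ord_inj.
have : (n%:Z %| h l * (t%:Z - t'%:Z))%Z.
  have := rpredB d1 d2; rewrite opprD addrACA subrr add0r => H.
  by rewrite mulrBr.
rewrite dvdzE /= abszM Euclid_dvdM // => /orP[hd|]; first by rewrite dvdzE hd in nh.
by move=> tt'; rewrite (dvdn_dist_eq (ltn_ord t) (ltn_ord t') tt').
Qed.

(** A multiple of n in position [l] may be counted for all n candidates, but the factor 1 / n in
    [esum_multiples] cancels this, so the bound stays free of n. *)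
Lemma average_bound z l :
  (\sum_(t < n) \esum_(h in [set h | last_nonzero l h && in_dual n (setz z l t) T h])
     (w h `^ p)%:E <= (1 + cR * m `^ p)%:E * W l)%E.
Proof.
pose D h : \bar R := (if (n%:Z %| h l)%Z then (w h `^ p)%:E else 0)%E.
have D0 h : (0 <= D h)%E by rewrite /D; case: ifP => // _; rewrite lee_fin powR_ge0.
have -> : (\sum_(t < n) \esum_(h in [set h | last_nonzero l h && in_dual n (setz z l t) T h])
     (w h `^ p)%:E = \esum_(h in [set h | last_nonzero l h])
     \sum_(t < n) (if in_dual n (setz z l t) T h then (w h `^ p)%:E else 0))%E.
  rewrite esum_sum; last by move=> h t _ _; case: ifP => // _; rewrite lee_fin powR_ge0.
  apply: eq_bigr => t _.
  by rewrite esum_mkcond_andb.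
apply: (@le_trans _ _ (\esum_(h in [set h | last_nonzero l h])
    ((w h `^ p)%:E + n%:R%:E * D h))%E).
  apply: le_esum => h _.
  have -> : (\sum_(t < n) (if in_dual n (setz z l t) T h then (w h `^ p)%:E else 0) =
      ((\sum_(t < n) in_dual n (setz z l t) T h)%:R * w h `^ p)%:E)%E.
    rewrite natr_sum mulr_suml -sumEFin; apply: eq_bigr => t _.
    by case: in_dual; rewrite ?mul1r ?mul0r.
  have := card_dual_setz z l h; rewrite -(ler_nat R) /D => hc.
  have := ler_wpM2r (powR_ge0 (w h) p) hc.
  by case: (n%:Z %| h l)%Z; rewrite ?muln1 ?muln0 ?mule0 ?adde0 -?EFinM -?EFinD lee_fin natrD ?mulrDl ?mul1r ?mul0r ?addr0.
rewrite esumD; [|by move=> h _; rewrite lee_fin powR_ge0|by move=> h _; rewrite mule_ge0 // lee_fin].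
rewrite esumZl //.
have -> : (\esum_(h in [set h | last_nonzero l h]) D h =
    \esum_(h in [set h | last_nonzero l h && (n%:Z %| h l)%Z]) (w h `^ p)%:E)%E.
  by rewrite [RHS]esum_mkcond_andb.
apply: (@le_trans _ _ (W l + n%:R%:E * ((cR * m `^ p / n%:R)%:E * W l)))%E.
  by rewrite leeD2l // lee_wpmul2l ?lee_fin // esum_multiples.
rewrite muleA -EFinM (_ : n%:R * _ = cR * m `^ p); last by field; rewrite gt_eqF.
by rewrite EFinD ge0_muleDl ?mul1e // lee_fin mulr_ge0 ?powR_ge0 // ltW.
Qed.

Variable z : 'I_d -> nat.
Hypotheses (Hz : forall j, (z j < n)%N) (Hz1 : forall j : 'I_d, val j = 0%N -> (0 < z j)%N)
  (Hcbc : forall l : 'I_d, (0 < val l)%N -> forall z' : nat, (z' < n)%N ->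
     (B_crit Rf alpha beta0 beta1 I n z l <=
      B_crit Rf alpha beta0 beta1 I n (fun j => if j == l then z' else z j) l)%E).

Let E l z := (\esum_(h in [set h | last_nonzero l h && in_dual n z T h]) (w h)%:E)%E.

Lemma cbc_step l : (E l z `^ p <= ((1 + cR) * m `^ p / n%:R)%:E * W l)%E.
Proof.
have l1 : 1 <= lam by case/andP: Hlam.
have Ele z' : (E l z' `^ p <=
    \esum_(h in [set h | last_nonzero l h && in_dual n z' T h]) (w h `^ p)%:E)%E.
  set V := (X in (_ <= X)%E).
  have V0 : (0 <= V)%E by apply: esum_ge0 => h _; rewrite lee_fin powR_ge0.
  have E0 : (0 <= E l z')%E by apply: esum_ge0 => h _; rewrite lee_fin.
  have -> : V = ((V `^ lam) `^ p)%E by rewrite -poweRrM mulfV ?gt_eqF // poweRe1.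
  apply: gt0_ler_poweR; first exact: ltW.
  - by rewrite in_itv /= E0 leey.
  - by rewrite in_itv /= poweR_ge0 leey.
  exact: esum_le_poweR.
have mp1 := maxcard_powR_ge1.
(* The first component is not minimised. But there h . z reduces to one product, and as n is prime
   and 0 < z_1 < n, every dual [h] has its entry divisible by n; [esum_multiples] suffices. *)
case: (posnP (val l)) => [l0|lpos].
  apply: (le_trans (Ele z)); apply: (@le_trans _ _ ((cR * m `^ p / n%:R)%:E * W l)%E); last first.
    rewrite lee_wpmul2r ?W_ge0 // lee_fin ler_wpM2r ?invr_ge0 ?(ltW nR) //.
    by rewrite ler_wpM2r ?powR_ge0 // lerDr.
  apply: le_trans (esum_multiples l).
  apply: (@esum_le_inj _ _ _ _ _ id) => // h /= /andP[lh]; rewrite lh /= /in_dual.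
  rewrite (bigD1 l) ?inE //= big1 ?addr0; last first.
    move=> j /andP[_ jl]; case/andP: lh => _ /forallP /(_ j).
    have -> : (l < j)%N by rewrite [nat_of_ord l]l0 lt0n; apply: contra_neq jl => j0; apply: ord_inj; rewrite j0.
    by move=> /eqP ->; rewrite mul0r.
  rewrite dvdzE /= abszM Euclid_dvdM // => /orP[|zl]; first by rewrite dvdzE.
  by have := dvdn_leq (Hz1 l0) zl; rewrite leqNgt Hz.
have key t : (t < n)%N -> (E l z `^ p <= \esum_(h in [set h | last_nonzero l h &&
    in_dual n (setz z l t) T h]) (w h `^ p)%:E)%E.
  move=> tn; apply: le_trans (Ele (setz z l t)).
  have E0 z' : (0 <= E l z')%E by apply: esum_ge0 => h _; rewrite lee_fin.
  apply: gt0_ler_poweR; [exact: ltW|by rewrite in_itv /= E0 leey|by rewrite in_itv /= E0 leey|].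
  rewrite /E -!B_critE // lee_wpmul2l ?lee_fin ?exprn_ge0 ?(ltW Hb0) //.
  exact: Hcbc.
have : (n%:R%:E * E l z `^ p <= (1 + cR * m `^ p)%:E * W l)%E.
  apply: le_trans (average_bound z l).
  have -> : (n%:R%:E * E l z `^ p = \sum_(t < n) 1%:E * E l z `^ p)%E.
    by rewrite -ge0_sume_distrl // sumEFin sumr_const card_ord.
  by apply: lee_sum => t _; rewrite mul1e; exact: key.
move=> h; have nV : (0 <= n%:R^-1 :> R) by rewrite invr_ge0 ltW.
have := lee_wpmul2l (_ : (0 <= (n%:R^-1 : R)%:E)%E) h; rewrite lee_fin => /(_ nV).
rewrite !muleA -!EFinM mulVf ?gt_eqF // mul1e => h'; apply: (le_trans h').
(* Since m^p is at least 1, 1 + cR m^p is at most (1 + cR) m^p. *)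
rewrite lee_wpmul2r ?W_ge0 // lee_fin mulrC ler_wpM2r // mulrDl mul1r.
by rewrite lerD2r.
Qed.

(** As lam >= 1, a sum of lam-th powers is at most the lam-th power of the sum, so adding the d
    steps costs no factor depending on d. *)
Lemma cbc_bound : (\esum_(h in [set h | dualnz n z h]) (w h)%:E <=
  ((1 + cR) `^ lam * m / (n%:R `^ lam))%:E * C_const Rf alpha beta0 beta1 I lam)%E.
Proof.
have l1 : 1 <= lam by case/andP: Hlam.
pose k : R := (1 + cR) * m `^ p / n%:R.
have cR1 : 0 < 1 + cR by rewrite addr_gt0.
have m0 : 0 < m by apply: lt_le_trans maxcard_ge1.
(* The exponent 1 / lam on [m] in each step becomes 1 here, so [#|I|] enters linearly. *)
have kE : (1 + cR) `^ lam * m / (n%:R `^ lam) = k `^ lam.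
  rewrite /k !powRM ?mulr_ge0 ?powR_ge0 ?invr_ge0 // ?(ltW cR1) ?(ltW nR) //.
  rewrite -powRrM mulVf ?gt_eqF // powRr1 ?(ltW m0) //; congr (_ * _).
  have nl0 : n%:R `^ lam != 0 :> R by rewrite gt_eqF // powR_gt0.
  apply: (mulIf nl0); rewrite mulVf // -powRM ?invr_ge0 ?(ltW nR) //.
  by rewrite mulVf ?gt_eqF // powR1.
have k0 : 0 < k by rewrite divr_gt0 ?mulr_gt0 ?powR_gt0.
have CE : C_const Rf alpha beta0 beta1 I lam = ((\sum_l W l) `^ lam)%E.
  rewrite -esum_last_nonzero; last by move=> h; rewrite lee_fin powR_ge0.
  congr (esum _ _ `^ lam)%E; apply/seteqP; split => h /= => [/existsP[j hj]|h0].
    by apply: contra_neq hj => ->; rewrite ffunE.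
  by have [j /andP[hj _]] := exists_last_nonzero h0; apply/existsP; exists j.
rewrite CE kE; set S := (\sum_l W l)%E.
have S0 : (0 <= S)%E by apply: sume_ge0 => l _; exact: W_ge0.
(* If [S] is infinite, so is the right-hand side because k > 0; otherwise real powers can be
   used. *)
have [Sinf|Sfin] := eqVneq S +oo%E.
  by rewrite Sinf poweRyr ?gt_eqF // gt0_muley ?leey // lte_fin powR_gt0.
have Wfin l : W l = (fine (W l))%:E.
  rewrite fineK // ge0_fin_numE ?W_ge0 //.
  have : (S < +oo)%E by rewrite ltey.
  apply: le_lt_trans; rewrite /S (bigD1 l) //= leeDl // sume_ge0 // => l' _; exact: W_ge0.
have -> : (\esum_(h in [set h | dualnz n z h]) (w h)%:E = \sum_l E l z)%E.
  pose f h : \bar R := (if in_dual n z T h then (w h)%:E else 0)%E.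
  have -> : (\esum_(h in [set h | dualnz n z h]) (w h)%:E =
      \esum_(h in [set h : K | h != 0%R]) f h)%E.
    by rewrite /dualnz esum_mkcond_andb.
  rewrite esum_last_nonzero; last by move=> h; rewrite /f; case: ifP => // _; rewrite lee_fin.
  by apply: eq_bigr => l _; rewrite /E [RHS]esum_mkcond_andb.
apply: (@le_trans _ _ (\sum_l ((k * fine (W l)) `^ lam)%:E)%E).
  apply: lee_sum => l _.
  have E0 : (0 <= E l z)%E by apply: esum_ge0 => h _; rewrite lee_fin.
  have -> : E l z = ((E l z `^ p) `^ lam)%E by rewrite -poweRrM mulVf ?gt_eqF // poweRe1.
  rewrite -poweR_EFin; apply: gt0_ler_poweR; first exact: ltW.
  - by rewrite in_itv /= poweR_ge0 leey.
  - by rewrite in_itv /= lee_fin mulr_ge0 ?fine_ge0 ?W_ge0 ?(ltW k0) // leey.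
  by rewrite EFinM -Wfin; exact: cbc_step.
have -> : S = (\sum_l fine (W l))%:E.
  by rewrite /S -sumEFin; apply: eq_bigr => l _; exact: Wfin.
rewrite sumEFin poweR_EFin -EFinM lee_fin.
have f0 l : 0 <= fine (W l) by rewrite fine_ge0 ?W_ge0.
rewrite -powRM ?sumr_ge0 ?(ltW k0) // mulr_sumr.
by apply: sum_powR_le => // l; rewrite mulr_ge0 // ltW.
Qed.

End Exponent.

End ComponentByComponent.

(** * From single integrands to the worst case error *)

Section WorstCaseError.
Context {R : realType} {d : nat}.
Variables (Rf : R -> R) (alpha beta0 beta1 : R) (I : {set 'I_d}).
Local Notation K := {ffun 'I_d -> int}.

(** Squaring a bound on the supremum requires its nonnegativity; the zero function lies in the unit
    ball. *)
Lemma wce_ge0 n (z : 'I_d -> nat) (Delta : 'rV[R]_d) :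
  (0 <= wce Rf alpha beta0 beta1 I n z Delta)%E.
Proof.
have F0 : Fnorm2 Rf alpha beta0 beta1 (@CFun R d (fun=> 0) (fun=> 0)) = 0%E.
  apply: esum1 => k _; have -> : fourier_re (@CFun R d (fun=> 0) (fun=> 0)) k = 0.
    by rewrite /fourier_re /=; under eq_fun do rewrite !mul0r addr0; exact: iter_int_cst.
  have -> : fourier_im (@CFun R d (fun=> 0) (fun=> 0)) k = 0.
    by rewrite /fourier_im /=; under eq_fun do rewrite !mul0r subr0; exact: iter_int_cst.
  by rewrite expr0n addr0 mul0r.
apply: le_trans (_ : (cubature_err n z Delta (@CFun R d (fun=> 0) (fun=> 0)))%:E <= _)%E.
  by rewrite lee_fin sqrtr_ge0.
apply: ereal_sup_ubound; exists (CFun (fun=> 0) (fun=> 0)) => //; split; last by rewrite F0.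
by split => //; split; [exact: cst_continuous|split; [exact: cst_continuous|rewrite F0]].
Qed.

End WorstCaseError.

Theorem theorem4p5 (R : realType) (Rf : R -> R) (cR alpha beta0 beta1 : R)
  (HRpos : forall x : R, 1 <= x -> 0 < Rf x)
  (HcR : 1 <= cR)
  (HRmul : forall n m : nat, (0 < n)%N -> (0 < m)%N ->
     cR^-1 * Rf m%:R <= Rf (n * m)%:R / n%:R <= Rf m%:R)
  (Halpha : 0 <= alpha)
  (Hmu : (\esum_(m in [set m : nat | (0 < m)%N])
            ((Rf m%:R) `^ (- (2 * alpha)))%:E < +oo)%E)
  (Hbeta0 : 0 < beta0) (Hbeta1 : 0 < beta1)
  (d : nat) (Hd : (0 < d)%N) (I : {set 'I_d})
  (n : nat) (Hn : prime n) (HncR : cR <= n%:R)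
  (z : 'I_d -> nat)
  (Hz : forall j, (z j < n)%N)
  (Hz1 : forall j : 'I_d, val j = 0%N -> (0 < z j)%N)
  (Hcbc : forall l : 'I_d, (0 < val l)%N ->
     forall z' : nat, (z' < n)%N ->
       (B_crit Rf alpha beta0 beta1 I n z l <=
        B_crit Rf alpha beta0 beta1 I n (fun j => if j == l then z' else z j) l)%E) :
  exists Delta : 'rV[R]_d,
    (forall i, 0 <= Delta ord0 i < 1) /\
    forall lam : R, 1 <= lam < 2 * alpha ->
      (wce Rf alpha beta0 beta1 I n z Delta * wce Rf alpha beta0 beta1 I n z Delta
       <= ((1 + cR) `^ lam * (maxn 1 #|I|)%:R / (n%:R `^ lam))%:E
          * C_const Rf alpha beta0 beta1 I lam)%E.
Proof.
have n0 := prime_gt0 Hn.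
set M := (\esum_(h in [set h | dualnz n z h]) (weight Rf alpha beta0 beta1 I h)%:E)%E.
have bound lam : 1 <= lam < 2 * alpha -> (M <=
    ((1 + cR) `^ lam * (maxn 1 #|I|)%:R / (n%:R `^ lam))%:E * C_const Rf alpha beta0 beta1 I lam)%E.
  by move=> Hlam; exact: cbc_bound.
have M0 : (0 <= M)%E by apply: esum_ge0 => h _; rewrite lee_fin weight_ge0.
(* If [M] is infinite, [bound] makes the right-hand side infinite for every admissible lam, and any
   shift will do. *)
have [Minf|Mfin] := eqVneq M +oo%E.
  exists 0; split => [i|lam /bound]; first by rewrite mxE lexx ltr01.
  by rewrite Minf; apply: le_trans; rewrite leey.
have ME : M = (fine M)%:E by rewrite fineK // ge0_fin_numE // ltey.
have [C HC] := sum_r_inv_bounded (d := d) HRpos Hbeta0 Hbeta1 Hmu.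
have [Delta Delta01 HDelta] : exists2 Delta : 'rV[R]_d, (forall i, 0 <= Delta ord0 i < 1) &
    forall N, shift_sum Rf alpha beta0 beta1 n z I N Delta <= fine M.
  by apply: exists_shift => //; rewrite -ME.
exists Delta; split => // lam /bound; apply: le_trans.
have wM : (wce Rf alpha beta0 beta1 I n z Delta <= (Num.sqrt (fine M))%:E)%E.
  apply: ge_ereal_sup => _ [f [fS f1] <-]; rewrite lee_fin.
  exact: (cubature_err_le HRpos Hbeta0 Hbeta1 n0 HC HDelta).
apply: (le_trans (lee_pmul (wce_ge0 _ _ _ _ _ _ _ _) (wce_ge0 _ _ _ _ _ _ _ _) wM wM)).
by rewrite -EFinM -expr2 sqr_sqrtr ?fine_ge0 // -ME.
Qed.
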